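(* Let $A$ be a regular, commutative, unital, complex normed algebra and let $B_{\mathcal U}$ be a standard normed extension of $A$ with respect to a set of monic polynomials $\mathcal U\subseteq A[x]$. Then the completion of $B_{\mathcal U}$ is regular.
   Context: For a commutative unital normed algebra $A$, $\Omega(A)$ is the space of continuous characters with the weak-* topology and $\hat a(\omega)=\omega(a)$. $A$ is regular if for each closed $E\subseteq\Omega(A)$ and $\omega\in\Omega(A)-E$ there exists $a\in A$ with $\hat a(E)\subseteq\{0\}$ and $\hat a(\omega)=1$. Arens–Hoffman extension: for a commutative unital normed algebra $C$ and monic $\alpha(x)=a_0+\cdots+a_{n-1}x^{n-1}+x^n\in C[x]$, it is $C_\alpha=C[x]/(\alpha(x))$ with norm $\|\sum_{k=0}^{n-1}b_k\bar x^k\|=\sum_{k=0}^{n-1}\|b_k\|t^k$ ($b_k\in C$, $\bar x$ the coset of $x$), for a chosen $t>0$ with $t^n\ge\sum_{k=0}^{n-1}\|a_k\|t^k$; $C$ is identified with its isometric image in $C_\alpha$. Standard extension: let $\mathcal U$ be a set of monic polynomials over $A$, well-ordered by $\le$ with least element $\alpha_0$. A standard extension of $A$ with respect to $\mathcal U$ is a normed algebra $B_{\mathcal U}\supseteq A$ with subalgebras $(B_\alpha)_{\alpha\in\mathcal U}$ such that $B_{\mathcal U}=\bigcup_{\alpha\in\mathcal U}B_\alpha$; $B_\alpha\subseteq B_\beta$ if $\alpha\le\beta$; and for every $\beta\in\mathcal U$ there is an isometric isomorphism $\psi_\beta$ from an Arens–Hoffman extension of $B_{<\beta}$ by $\beta(x)$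 onto $B_\beta$ with $\psi_\beta(b)=b$ for all $b\in B_{<\beta}$, where $B_{<\beta}=\bigcup_{\alpha<\beta}B_\alpha$ if $\beta>\alpha_0$ and $B_{<\alpha_0}=A$. (Such extensions exist by a theorem of Lindberg.) *)

(* Defs.v *)
From HB Require Import structures.
From mathcomp Require Import all_boot all_order all_algebra qpoly.
From mathcomp Require Import all_classical all_reals all_analysis.
From mathcomp.classical Require Import wochoice.
From mathcomp.real_closed Require Import complex.

Set Implicit Arguments.
Unset Strict Implicit.
Unset Printing Implicit Defensive.

Import Order.TTheory GRing.Theory Num.Theory.
Import Pdiv.CommonRing Pdiv.RingMonic.
Import numFieldNormedType.Exports.

Local Open Scope classical_set_scope.
Local Open Scope ring_scope.

(* A plain record, because an HB structure joining rings and normed modules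
   would be a missing join below numDomainType. As in normedModType, norms are valued in the scalar field (they are
   automatically nonnegative, hence real). Algebras are unital with 1 != 0, and
   the norm of 1 is not required to be 1. *)
Record normedComAlg (K : numFieldType) := NormedComAlg {
  nca_alg : comAlgType K;
  nca_norm : nca_alg -> K;
  nca_normD : forall x y, nca_norm (x + y) <= nca_norm x + nca_norm y;
  nca_normZ : forall (l : K) x, nca_norm (l *: x) = `|l| * nca_norm x;
  nca_norm_eq0 : forall x, nca_norm x = 0 -> x = 0;
  nca_normM : forall x y, nca_norm (x * y) <= nca_norm x * nca_norm y
}.

Definition nca_sort (K : numFieldType) (A : normedComAlg K) : Type := nca_alg A.
Coercion nca_sort : normedComAlg >-> Sortclass.

HB.instance Definition _ (K : numFieldType) (A : normedComAlg K) :=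
  GRing.ComAlgebra.copy (nca_sort A) (nca_alg A).
HB.instance Definition _ (K : numFieldType) (A : normedComAlg K) :=
  Lmodule_isNormed.Build K (nca_sort A)
    (@nca_normD K A) (@nca_normZ K A) (@nca_norm_eq0 K A).

Lemma normrM_le (K : numFieldType) (A : normedComAlg K) (x y : A) :
  `|x * y| <= `|x| * `|y|.
Proof. exact: nca_normM. Qed.

Definition isometric (K : numFieldType) (A B : normedComAlg K) (f : A -> B) :=
  forall x, `|f x| = `|x|.

Record character (K : numFieldType) (A : normedComAlg K) := Character {
  character_map :> {lrmorphism A -> K^o};
  character_continuous : continuous character_map
}.

HB.instance Definition _ (K : numFieldType) (A : normedComAlg K) :=
  gen_eqMixin (character A).
HB.instance Definition _ (K : numFieldType) (A : normedComAlg K) :=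
  gen_choiceMixin (character A).

Definition character_eval (K : numFieldType) (A : normedComAlg K)
  (w : character A) : {ptws A -> K^o} := w.

(* Weak-* topology: pointwise convergence on A. *)
HB.instance Definition _ (K : numFieldType) (A : normedComAlg K) :=
  Topological.copy (character A) (initial_topology (@character_eval K A)).

Definition gelfand (K : numFieldType) (A : normedComAlg K) (a : A) :
  character A -> K^o := fun w => w a.

Definition regular_algebra (K : numFieldType) (A : normedComAlg K) :=
  forall (E : set (character A)) (w : character A), closed E -> ~ E w ->
  exists a : A, gelfand a @` E `<=` [set 0] /\ gelfand a w = 1.

(* B -> D exhibits D as the completion of B, which is unique up to isometric
   isomorphism. *)
Definition is_completion (K : numFieldType) (B D : normedComAlg K)
    (j : {lrmorphism B -> D}) :=
  [/\ isometric j,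
      dense (range j) &
      forall F : set_system D, ProperFilter F -> cauchy F -> cvg F].

Section Subalgebra.
Context {K : numFieldType} {B : normedComAlg K} (S : subalgClosed B).

Definition subalg_type := {x : B | x \in S}.

HB.instance Definition _ := SubChoice.on subalg_type.
HB.instance Definition _ := [SubChoice_isSubAlgebra of subalg_type by <:].
HB.instance Definition _ := [SubNzRing_isSubComNzRing of subalg_type by <:].

Let subalg_norm (x : subalg_type) : K := `|val x|.

Fact subalg_normD x y : subalg_norm (x + y) <= subalg_norm x + subalg_norm y.
Proof. by rewrite /subalg_norm raddfD ler_normD. Qed.

Fact subalg_normZ (l : K) x : subalg_norm (l *: x) = `|l| * subalg_norm x.
Proof. by rewrite /subalg_norm linearZ normrZ. Qed.

Fact subalg_norm_eq0 x : subalg_norm x = 0 -> x = 0.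
Proof. by move/normr0_eq0 => x0; apply: val_inj; rewrite x0 raddf0. Qed.

Fact subalg_normM x y : subalg_norm (x * y) <= subalg_norm x * subalg_norm y.
Proof. by rewrite /subalg_norm rmorphM normrM_le. Qed.

Definition subalg : normedComAlg K :=
  NormedComAlg subalg_normD subalg_normZ subalg_norm_eq0 subalg_normM.

Definition subalg_val : subalg -> B := val : subalg_type -> B.

Fact subalg_val_linear : linear subalg_val.
Proof. exact: (linearP (val : subalg_type -> B)). Qed.

Fact subalg_val_monoid_morphism : monoid_morphism subalg_val.
Proof. by split; [exact: (rmorph1 (val : subalg_type -> B))|
                  exact: (rmorphM (val : subalg_type -> B))]. Qed.

HB.instance Definition _ :=
  GRing.isLinear.Build K subalg B _ subalg_val subalg_val_linear.
HB.instance Definition _ :=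
  GRing.isMonoidMorphism.Build subalg B subalg_val subalg_val_monoid_morphism.

End Subalgebra.

Section ArensHoffman.
Context {K : numFieldType} {C : normedComAlg K}.

(* For K = R[i], [0 < t] says that t is real and positive. *)
Definition arens_hoffman_param (alpha : {poly C}) (t : K) : Prop :=
  [/\ alpha \is monic, (1 < size alpha)%N, 0 < t &
      \sum_(k < (size alpha).-1) `|alpha`_k| * t ^+ k <= t ^+ (size alpha).-1].

Context {alpha : {poly C}} {t : K} (alpha_t : arens_hoffman_param alpha t).

(* Cosets are represented by their unique member of degree < deg alpha. *)
Definition arens_hoffman_type of arens_hoffman_param alpha t : Type :=
  {poly %/ alpha}.

Local Notation AH := (arens_hoffman_type alpha_t).

HB.instance Definition _ := GRing.ComNzRing.copy AH {poly %/ alpha}.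

Let AH_scale (l : K) (p : AH) : AH := (l%:A : C) *: (p : {poly %/ alpha}).

Fact AH_scalerA a b v : AH_scale a (AH_scale b v) = AH_scale (a * b) v.
Proof. by rewrite /AH_scale scalerA -scalerAl mul1r scalerA. Qed.

Fact AH_scale1r : left_id 1 AH_scale.
Proof. by move=> v; rewrite /AH_scale !scale1r. Qed.

Fact AH_scalerDr : right_distributive AH_scale +%R.
Proof. by move=> l u v; rewrite /AH_scale -scalerDr. Qed.

Fact AH_scalerDl v : {morph AH_scale^~ v : a b / a + b}.
Proof. by move=> a b; rewrite /AH_scale !scalerDl. Qed.

HB.instance Definition _ := GRing.Zmodule_isLmodule.Build K AH
  AH_scalerA AH_scale1r AH_scalerDr AH_scalerDl.

Fact AH_scalerAl (l : K) (u v : AH) : l *: (u * v) = (l *: u) * v.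
Proof.
apply: val_inj; rewrite /= -scalerAl -rmodpZ //; exact: monic_mk_monic.
Qed.

HB.instance Definition _ := GRing.Lmodule_isLalgebra.Build K AH AH_scalerAl.
HB.instance Definition _ := GRing.Lalgebra_isComAlgebra.Build K AH.

Let AH_norm (p : AH) : K :=
  \sum_(k < (size alpha).-1) `|(p : {poly C})`_k| * t ^+ k.

Let t_gt0 : 0 < t. Proof. by case: alpha_t. Qed.
Let t_ge0 k : 0 <= t ^+ k. Proof. exact/exprn_ge0/ltW. Qed.

Fact AH_normD x y : AH_norm (x + y) <= AH_norm x + AH_norm y.
Proof.
rewrite /AH_norm -big_split /=; apply: ler_sum => k _.
by rewrite coefD -mulrDl ler_wpM2r // ler_normD.
Qed.

Fact AH_normZ (l : K) x : AH_norm (l *: x) = `|l| * AH_norm x.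
Proof.
rewrite /AH_norm mulr_sumr; apply: eq_bigr => k _.
by rewrite /= coefZ -scalerAl mul1r normrZ mulrA.
Qed.

Let mk_monic_alpha : mk_monic alpha = alpha.
Proof. by case: alpha_t => mon sz _ _; rewrite /mk_monic sz mon. Qed.

Let size_AH (p : AH) : (size (p : {poly C}) <= (size alpha).-1)%N.
Proof. by move: (size_npoly p); rewrite {2}mk_monic_alpha. Qed.

Fact AH_norm_eq0 x : AH_norm x = 0 -> x = 0.
Proof.
move=> /psumr_eq0P x0; apply: val_inj; apply/polyP => k; rewrite coef0.
have [k_lt|k_ge] := ltnP k (size alpha).-1; last first.
  by rewrite nth_default // (leq_trans (size_AH x)).
have /eqP := x0 (fun i _ => mulr_ge0 (normr_ge0 _) (t_ge0 i)) (Ordinal k_lt) isT.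
by rewrite mulf_eq0 expf_eq0 (gt_eqF t_gt0) andbF orbF normr_eq0 => /eqP.
Qed.

Let W (p : {poly C}) : K := \sum_(k < (size alpha).-1) `|p`_k| * t ^+ k.

Let W_sum I (r : seq I) (F : I -> {poly C}) (G : I -> K) :
  (forall i, W (F i) <= G i) -> W (\sum_(i <- r) F i) <= \sum_(i <- r) G i.
Proof.
move=> FG; elim: r => [|i r IH].
  by rewrite !big_nil /W big1 // => k _; rewrite coef0 normr0 mul0r.
rewrite !big_cons; apply: le_trans (lerD (FG i) IH).
rewrite /W -big_split /=; apply: ler_sum => k _.
by rewrite coefD -mulrDl ler_wpM2r // ler_normD.
Qed.

Let W_rmodpXn m (c : C) : W (rmodp (c *: 'X^m) alpha) <= `|c| * t ^+ m.
Proof.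
have [mon sz _ le_t] := alpha_t.
have sz' : (size alpha).-1.+1 = size alpha by rewrite prednK // ltnW.
elim/ltn_ind: m c => m IH c.
have [m_lt|m_ge] := ltnP m (size alpha).-1.
  rewrite rmodp_small; last first.
    rewrite -sz' ltnS (leq_trans (size_scale_leq _ _)) // size_polyXn //.
  rewrite /W (bigD1 (Ordinal m_lt)) //= coefZ coefXn eqxx mulr1 big1 ?addr0 //.
  move=> k /negPf km; rewrite coefZ coefXn.
  by rewrite -[(k : nat) == m]/(k == Ordinal m_lt) km mulr0 normr0 mul0r.
pose n := (size alpha).-1; rewrite -/n in m_ge le_t.
have defXm : c *: 'X^m = (c *: 'X^(m - n)) * alpha +
    \sum_(i < n) (- (c * alpha`_i)) *: 'X^(m - n + i).
  have -> : alpha = \sum_(i < n) alpha`_i *: 'X^i + 'X^n.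
    rewrite -[LHS]coefK poly_def -sz' big_ord_recr /= -/n.
    by rewrite (monicP mon : alpha`_n = 1) scale1r.
  rewrite mulrDr -(scalerAl c _ 'X^n) -exprD subnK // addrAC mulr_sumr -big_split /= big1.
    by rewrite add0r.
  move=> i _; rewrite coefD coefXn (ltn_eqF (ltn_ord i)) addr0.
  rewrite coef_sum (bigD1 i) //= coefZ coefXn eqxx mulr1 big1 ?addr0.
    by rewrite -scalerAl -scalerAr -exprD scalerA scaleNr subrr.
  by move=> j /negPf ji; rewrite coefZ coefXn eq_sym
    -[(j : nat) == i]/(j == i) ji mulr0.
rewrite defXm rmodpD // rmodp_mull // add0r rmodp_sum //.
apply: le_trans (@W_sum _ _ _ (fun i : 'I_n =>
  `|- (c * alpha`_i)| * t ^+ (m - n + i)) _) _.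
  by move=> i; apply: IH; rewrite -{2}(subnK m_ge) ltn_add2l.
have -> : `|c| * t ^+ m = `|c| * t ^+ (m - n) * t ^+ n.
  by rewrite -mulrA -exprD subnK.
apply: le_trans (ler_wpM2l _ le_t); last by rewrite mulr_ge0.
rewrite mulr_sumr; apply: ler_sum => i _.
by rewrite normrN exprD mulrACA ler_wpM2r ?mulr_ge0 // normrM_le.
Qed.

Fact AH_normM x y : AH_norm (x * y) <= AH_norm x * AH_norm y.
Proof.
have [mon _ _ _] := alpha_t; pose n := (size alpha).-1.
have defP (p : AH) : (p : {poly C}) = \sum_(i < n) (p : {poly C})`_i *: 'X^i.
  rewrite -poly_def; apply/polyP => k; rewrite coef_poly; case: ltnP => // nk.
  by rewrite nth_default // (leq_trans (size_AH p)).
have -> : AH_norm (x * y) = W (rmodp ((x : {poly C}) * (y : {poly C})) alpha).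
  apply: eq_bigr => k _; congr (`|_`_k| * _).
  exact: (congr1 (fun a => polyseq (rmodp ((x : {poly C}) * (y : {poly C})) a))
    mk_monic_alpha).
rewrite (defP x) (defP y) mulr_suml rmodp_sum // /AH_norm mulr_suml.
apply: W_sum => i; rewrite mulr_sumr rmodp_sum // mulr_sumr.
apply: W_sum => j; rewrite -scalerAl -scalerAr scalerA -exprD.
apply: le_trans (W_rmodpXn _ _) _.
by rewrite exprD mulrACA ler_wpM2r ?mulr_ge0 // normrM_le.
Qed.

Definition arens_hoffman : normedComAlg K :=
  NormedComAlg AH_normD AH_normZ AH_norm_eq0 AH_normM.

Definition arens_hoffman_inj (c : C) : arens_hoffman := qpolyC alpha c.

End ArensHoffman.

Section StandardExtension.
Context {K : numFieldType} {A B : normedComAlg K}.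

(* The inclusion of A in its extension B is the morphism iota. The subalgebras
   of the family are only relevant at the members of U. *)
Context (iota : {lrmorphism A -> B}).
Context (U : set {poly A}) (le : rel {poly A}) (alpha0 : {poly A}).
Context (Bs : {poly A} -> subalgClosed B).

Definition below (beta : {poly A}) : set B :=
  if beta == alpha0 then range iota
  else \bigcup_(alpha in [set a | [/\ U a, le a beta & a != beta]]) [set` Bs alpha].

(* The subalgebra D of B is isomorphic over its subalgebra C to an
   Arens-Hoffman extension of C by p, a polynomial whose coefficients lie in C.
   The parameter condition makes p monic and non-constant; for p = 1 the
   quotient C[x]/(p) is null and cannot contain C. *)
Definition arens_hoffman_step (C D : subalgClosed B) (p : {poly B}) : Prop :=
  exists (pC : {poly subalg C}) (t : K) (pC_t : arens_hoffman_param pC t)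
         (psi : {lrmorphism arens_hoffman pC_t -> B}),
    [/\ map_poly (@subalg_val K B C) pC = p,
        isometric psi,
        range psi = [set` D] &
        forall c : subalg C, psi (arens_hoffman_inj pC_t c) = @subalg_val K B C c].

Record standard_extension : Prop := StandardExtension {
  se_isometric : isometric iota;
  se_monic : forall alpha, U alpha -> alpha \is monic;
  (* [wo_chain] includes reflexivity, antisymmetry and transitivity on U. *)
  se_well_order : wo_chain le [in U];
  se_least : U alpha0 /\ (forall alpha, U alpha -> le alpha0 alpha);
  se_cover : \bigcup_(alpha in U) [set` Bs alpha] = [set: B];
  se_mono : forall alpha beta, U alpha -> U beta -> le alpha beta ->
    [set` Bs alpha] `<=` [set` Bs beta];
  se_step : forall beta, U beta -> exists2 C : subalgClosed B,
    [set` C] = below beta & arens_hoffman_step C (Bs beta) (map_poly iota beta)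
}.

End StandardExtension.

(* Main.v *)
From HB Require Import structures.
Require Import Defs.
From mathcomp Require Import all_boot all_order all_algebra qpoly mxpoly.
From mathcomp Require Import all_classical all_reals all_analysis.
From mathcomp.classical Require Import wochoice.
From mathcomp.real_closed Require Import complex.
From mathcomp Require Import ring lra.

Set Implicit Arguments.
Unset Strict Implicit.
Unset Printing Implicit Defensive.

Import Order.TTheory GRing.Theory Num.Theory.
Import Pdiv.CommonRing Pdiv.RingMonic.
Import numFieldNormedType.Exports.

Local Open Scope classical_set_scope.
Local Open Scope complex_scope.
Local Open Scope ring_scope.

(** A character of an algebra is a point, and its weak-* neighbourhoods are given by
    pointwise convergence. For a character [w] of [D], the sets of characters
    outside which the Gelfand transform of some [d] with [w d = 1] vanishes form a
    filter, and [D] is regular as soon as this filter contains all the sets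
    [{phi : |phi x - w x| < e}]. An element [x] with this property for all [w] and
    [e] is called separating. Regularity of [A] makes the images of its elements
    separating ([regular_separating]), and separating elements are closed under
    limits ([separating_limit]). Every stage of a standard extension adjoins a
    root of a monic polynomial over [A], so all elements of [B] are integral over
    [A] ([standard_extension_integral]). As the image of [B] is dense in [D],
    everything follows from [separating_root]: a root in [D] of a monic polynomial
    with separating coefficients is separating.

    Let [x] be such a root. Near [w], the roots of the polynomial obtained by
    applying a character to the coefficients are close to those at [w], so the
    value of [x] is either close to [w x] or far from it. The ideal [J] of the
    elements vanishing on such a neighbourhood is killed by nearby characters
    only, because the coefficients are separating. The part of the spectrum of
    [x] modulo [J] near [w x] is thus isolated, and its Riesz idempotent, times an
    element that vanishes off the neighbourhood, is the element required by
    regularity ([separating_idempotent]).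

    The Banach algebra theory is reduced to an elementary device. The average of
    the resolvents [(1 - z *: a)^-1] over the points [z] of a circle that differ by
    roots of unity is the inverse of [1 - (s *: a) ^+ n], and it is bounded and
    Lipschitz in the radius [s] uniformly in [n] ([resolvent_means]). On a disc
    this yields Rickart's proof of the spectral radius formula ([rickart]), whence
    the Gelfand-Mazur theorem and the criterion of invertibility by characters
    ([gelfand_invertible]). On an annulus that avoids the spectrum, the averages
    are approximate idempotents ([approximate_idempotent]), which a square root
    turns into exact ones ([exact_idempotent]). All this is done modulo an ideal,
    with representatives in [D]. *)

(** * Real-valued norms *)
Section RealNorm.
Context {R : realType} {V : normedZmodType R[i]}.
Implicit Types x y : V.

(** Norms are valued in [R[i]], whose order is partial; their real parts live in
    a totally ordered field. *)
Definition nrm (x : V) : R := complex.Re `|x|.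

Lemma nrmE x : (nrm x)%:C = `|x|.
Proof. by apply: RRe_real; apply: ger0_real; exact: normr_ge0. Qed.

Lemma nrm_ge0 x : 0 <= nrm x.
Proof. by rewrite -ler0c nrmE normr_ge0. Qed.

Lemma nrm0 : nrm (0 : V) = 0.
Proof. by rewrite /nrm normr0. Qed.

Lemma nrmN x : nrm (- x) = nrm x.
Proof. by rewrite /nrm normrN. Qed.

Lemma nrmB x y : nrm (x - y) = nrm (y - x).
Proof. by rewrite /nrm distrC. Qed.

Lemma nrmD x y : nrm (x + y) <= nrm x + nrm y.
Proof. by rewrite -lecR rmorphD /= !nrmE ler_normD. Qed.

Lemma nrm_small_eq0 x : (forall e, 0 < e -> nrm x <= e) -> x = 0.
Proof.
move=> x0; apply: normr0_eq0; rewrite -nrmE; congr (_%:C); apply/eqP.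
by rewrite eq_le nrm_ge0 andbT; apply/ler_addgt0Pl => e /x0; rewrite addr0.
Qed.

End RealNorm.

Section Modulus.
Context {R : realType}.
Implicit Types z : R[i].

Lemma nrmcM z z' : nrm (z * z') = nrm z * nrm z'.
Proof. by apply: complexI; rewrite rmorphM /= !nrmE normrM. Qed.

Lemma nrmcX z n : nrm (z ^+ n) = nrm z ^+ n.
Proof. by apply: complexI; rewrite rmorphXn /= !nrmE normrX. Qed.

Lemma nrmcV z : nrm z^-1 = (nrm z)^-1.
Proof. by apply: complexI; rewrite fmorphV /= !nrmE normfV. Qed.

Lemma nrm_real (r : R) : 0 <= r -> nrm r%:C = r.
Proof. by move=> r0; apply: complexI; rewrite nrmE ger0_norm // ler0c. Qed.

Lemma nrmc_eq0 z : (nrm z == 0) = (z == 0).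
Proof.
by rewrite -[RHS]normr_eq0 -nrmE; apply/eqP/eqP => [->|/complexI].
Qed.

Lemma nrmc_nat n : nrm (n%:R : R[i]) = n%:R.
Proof. by rewrite -(rmorph_nat (real_complex R)) nrm_real // ler0n. Qed.

Lemma nrmc1 : nrm (1 : R[i]) = 1.
Proof. exact: (nrmc_nat 1). Qed.

Lemma nrmc_Re_Im z : nrm z <= `|complex.Re z| + `|complex.Im z|.
Proof.
rewrite [z in nrm z]complexE (le_trans (nrmD _ _)) // nrmcM.
rewrite lerD // -lecR; last rewrite rmorphM /=; rewrite !nrmE.
  by rewrite !normc_def /= lecR expr0n addr0 sqrtr_sqr.
by rewrite !normc_def /= -!rmorphM lecR /= !expr0n /= addr0 add0r expr1n sqrtr1 sqrtr_sqr mul1r.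
Qed.

Lemma Re_le_nrmc z : `|complex.Re z| <= nrm z.
Proof.
by rewrite /nrm normc_def /= -sqrtr_sqr ler_sqrt ?lerDl ?addr_ge0 ?sqr_ge0.
Qed.

Lemma Im_le_nrmc z : `|complex.Im z| <= nrm z.
Proof.
by rewrite /nrm normc_def /= -sqrtr_sqr ler_sqrt ?lerDr ?addr_ge0 ?sqr_ge0.
Qed.

End Modulus.

Section AlgebraNorm.
Context {R : realType} {D : normedComAlg R[i]}.
Implicit Types (x y : D) (z : R[i]).

Lemma nrmZ z x : nrm (z *: x) = nrm z * nrm x.
Proof. by apply: complexI; rewrite rmorphM /= !nrmE normrZ. Qed.

Lemma nrmM x y : nrm (x * y) <= nrm x * nrm y.
Proof. by rewrite -lecR rmorphM /= !nrmE normrM_le. Qed.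

Lemma nrmX x n : nrm (x ^+ n) <= nrm (1 : D) * nrm x ^+ n.
Proof.
elim: n => [|n IH]; first by rewrite !expr0 mulr1.
rewrite !exprS (le_trans (nrmM _ _)) // mulrCA ler_wpM2l ?nrm_ge0 //.
Qed.

Lemma half_scaler x : (2^-1 : R[i]) *: x + (2^-1 : R[i]) *: x = x.
Proof.
by rewrite -scalerDl [X in X *: _](_ : _ = 1) ?scale1r // [RHS]splitr div1r.
Qed.

End AlgebraNorm.

(** * Inverses and square roots in a complete algebra *)
Definition complete_algebra {K : numFieldType} (D : normedComAlg K) :=
  forall F : set_system D, ProperFilter F -> cauchy F -> cvg F.

Section Complete.
Context {R : realType} {D : normedComAlg R[i]}.
Hypothesis D_complete : complete_algebra D.
Implicit Types (x y : D) (z : R[i]).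

Lemma geometric_cvg (u : nat -> D) (r C : R) : 0 <= r < 1 ->
  (forall n, nrm (u n.+1 - u n) <= C * r ^+ n) ->
  exists l, forall e, 0 < e -> exists N, forall n, (N <= n)%N -> nrm (u n - l) < e.
Proof.
move=> /andP[r0 r1] ur.
have C0 : 0 <= C by have := ur 0%N; rewrite expr0 mulr1; apply: le_trans; exact: nrm_ge0.
have step n k : nrm (u (n + k)%N - u n) <= C / (1 - r) * r ^+ n * (1 - r ^+ k).
  elim: k => [|k IH]; first by rewrite addn0 subrr nrm0 expr0 subrr mulr0.
  rewrite addnS -(subrKA (u (n + k)%N)) (le_trans (nrmD _ _)) //.
  apply: le_trans (lerD (ur _) IH) _.
  rewrite exprD exprS le_eqVlt; apply/orP; left; apply/eqP.
  by field; rewrite subr_eq0 gt_eqF.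
have step' n m : (n <= m)%N -> nrm (u m - u n) <= C / (1 - r) * r ^+ n.
  move=> nm; rewrite -(subnKC nm) (le_trans (step _ _)) // ler_piMr //.
    by rewrite mulr_ge0 ?exprn_ge0 ?divr_ge0 ?subr_ge0 // ltW.
  by rewrite gerBl exprn_ge0.
have small e : 0 < e -> exists N, C / (1 - r) * r ^+ N < e.
  move=> e0.
  have : (fun n => C / (1 - r) * r ^+ n) @ \oo --> (C / (1 - r) * 0 : R).
    by apply: cvgMr; apply: cvg_expr; rewrite ger0_norm.
  rewrite mulr0 => /cvgrPdist_lt /(_ e e0)[N _ /(_ N (leqnn N))].
  rewrite sub0r normrN ger0_norm; first by exists N.
  by rewrite mulr_ge0 ?exprn_ge0 ?divr_ge0 ?subr_ge0 // ltW.
have uC : cauchy (u @ \oo).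
  apply/cauchyP => e e0.
  have /small[N hN] : 0 < complex.Re e by move: e0; rewrite ltcE /= => /andP[].
  exists (u N); exists N => // n /= Nn.
  rewrite -ball_normE /= -nrmE nrmB.
  have -> : e = (complex.Re e)%:C by rewrite RRe_real // gtr0_real.
  by rewrite ltcR (le_lt_trans (step' _ _ Nn)).
have /cvg_ex[l /cvgrPdist_lt ul] : cvg (u @ \oo) by exact: D_complete.
exists l => e e0; have /ul[N _ hN] : 0 < e%:C by rewrite ltcR.
by exists N => n /hN /=; rewrite -nrmE ltcR nrmB.
Qed.

(** Inverses and square roots below are fixed points of contractions of a ball,
    whose radius then bounds them. *)
Lemma contraction_fixpoint (f : D -> D) (r k : R) : 0 <= k < 1 -> 0 <= r ->
  (forall y, nrm y <= r -> nrm (f y) <= r) ->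
  (forall y y', nrm y <= r -> nrm y' <= r -> nrm (f y - f y') <= k * nrm (y - y')) ->
  exists2 y, nrm y <= r & f y = y.
Proof.
move=> k01 r0 fr fk; pose u n := iter n f 0.
have ur n : nrm (u n) <= r by elim: n => [|n /fr //]; rewrite /= nrm0.
have [n|l ul] := @geometric_cvg u k (nrm (f 0)) k01.
  elim: n => [|n IH]; first by rewrite /= subr0 expr0 mulr1.
  rewrite (le_trans (fk _ _ (ur n.+1) (ur n))) // exprS mulrCA ler_wpM2l //.
  by case/andP: k01.
have lr : nrm l <= r.
  apply/ler_addgt0Pl => e /ul[N /(_ N (leqnn N)) hN].
  rewrite -[l](subrK (u N)) (le_trans (nrmD _ _)) // lerD // nrmB ltW //.
exists l => //; apply/eqP; rewrite -subr_eq0; apply/eqP.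
apply: nrm_small_eq0 => e e0; have /ul[N hN] : 0 < e / 2 by rewrite divr_gt0.
rewrite -(subrKA (f (u N))) (le_trans (nrmD _ _)) // (splitr e) lerD //.
  rewrite (le_trans (fk _ _ lr (ur N))) // nrmB (le_trans _ (ltW (hN _ (leqnn N)))) //.
  by rewrite ler_piMl ?nrm_ge0 // ltW //; case/andP: k01.
exact/ltW/(hN N.+1)/leqnSn.
Qed.

(** The inverse [y] of [1 - x] solves [y = 1 + x * y]. *)
Lemma neumann (x : D) : nrm x < 1 ->
  exists2 y, nrm y <= nrm (1 : D) / (1 - nrm x) & (1 - x) * y = 1.
Proof.
move=> x1; have x1' : 0 < 1 - nrm x by rewrite subr_gt0.
have [||y yr|y y'|y yr yE] := @contraction_fixpoint (fun y => 1 + x * y)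
  (nrm (1 : D) / (1 - nrm x)) (nrm x); first by rewrite nrm_ge0.
- by rewrite divr_ge0 ?nrm_ge0 // ltW.
- rewrite (le_trans (nrmD _ _)) // (le_trans (lerD (lexx _) (nrmM _ _))) //.
  rewrite (le_trans (lerD (lexx _) (ler_wpM2l (nrm_ge0 x) yr))) //.
  rewrite le_eqVlt; apply/orP; left; apply/eqP; field; exact: lt0r_neq0.
- by move=> _ _ /=; rewrite opprD addrACA subrr add0r -mulrBr nrmM.
by exists y => //; rewrite mulrBl mul1r -{1}yE addrK.
Qed.

(** Here [1 - y] is the square root of [1 - v], because [(1 - y) ^+ 2 = 1 - v]
    amounts to [y = (v + y ^+ 2) / 2], a contraction of the ball of radius [1 / 2].
    The bound on [y] singles out the root close to [1], as opposed to its negative. *)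
Lemma inv_sqrt (v : D) : nrm v <= 1 / 4 ->
  exists y g : D, [/\ nrm y <= 1 / 2, (1 - y) * g = 1 & g ^+ 2 * (1 - v) = 1].
Proof.
move=> v4.
have h2 x : nrm ((2^-1 : R[i]) *: x) = nrm x / 2.
  by rewrite nrmZ nrmcV (nrmc_nat 2) mulrC.
have [||y yr|y y' yr y'r|y yr yE] := @contraction_fixpoint
  (fun y => (2^-1 : R[i]) *: (v + y ^+ 2)) (1 / 2) (1 / 2); [lra|lra| | |].
- rewrite /= h2; have := nrmD v (y ^+ 2); rewrite expr2; have := nrmM y y.
  have := ler_pM (nrm_ge0 y) (nrm_ge0 y) yr yr; lra.
- rewrite /= -scalerBr h2 opprD addrACA subrr add0r subr_sqr.
  have := nrmM (y - y') (y + y'); have := nrmD y y'.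
  have := nrm_ge0 (y - y'); nra.
have [|g _ gE] := @neumann y; first by lra.
exists y, g; split => //.
have -> : 1 - v = (1 - y) ^+ 2.
  have : y + y = v + y ^+ 2.
    by rewrite -{1 2}yE half_scaler.
  move=> /(congr1 (fun t => 1 + y ^+ 2 - t)); rewrite -mulr2n => e.
  have -> : (1 - y) ^+ 2 = 1 + y ^+ 2 - y *+ 2 by ring.
  by rewrite e; ring.
by rewrite -exprMn mulrC gE expr1n.
Qed.

End Complete.

(** * Ideals and inverses modulo an ideal *)

(** Local bounds become uniform by compactness. The annulus sits in a square of
    [R * R], and a point of the square outside the annulus has a neighbourhood
    outside it, where there is nothing to bound. *)
Lemma annulus_compact {R : realType} (Q : R -> R[i] -> Prop) (s1 s2 : R) :
  (forall B B' z, B <= B' -> Q B z -> Q B' z) ->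
  (forall z, s1 <= nrm z <= s2 ->
     exists B, exists2 e, 0 < e & forall z', nrm (z' - z) < e -> Q B z') ->
  exists B, forall z, s1 <= nrm z <= s2 -> Q B z.
Proof.
move=> Qle Qloc; pose K := (`[- s2, s2]%classic `*` `[- s2, s2]%classic : set (R * R)).
have /compact_near_coveringP cK : compact K by apply: compact_setX; exact: segment_compact.
pose P (B : R) (p : R * R) := s1 <= nrm (p.1 +i* p.2) <= s2 -> Q B (p.1 +i* p.2).
have dist (p q : R * R) e : 0 < e -> ball p (e / 2) q -> nrm (q.1 +i* q.2 - (p.1 +i* p.2)) < e.
  move=> e0 [] /=; rewrite /ball /= => b1 b2; apply: le_lt_trans (nrmc_Re_Im _) _ => /=.
  by rewrite (splitr e) (distrC q.1) (distrC q.2) ltrD.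
have [p Kp|B [_ /(_ (B + 1))]] := cK _ (@pinfty_nbhs R) P _ _.
  set z := p.1 +i* p.2.
  have [zs|] := boolP (s1 <= nrm z <= s2).
    have [B [e e0 Qe]] := Qloc z zs.
    exists (ball p (e / 2), [set B' | B < B']); first split => /=.
    - by apply/nbhs_ballP; exists (e / 2) => //=; rewrite divr_gt0.
    - by exists B; split => //; exact: num_real.
    - by move=> [q B'] [/= pq BB'] _; apply: Qle (ltW BB') _; exact/Qe/dist.
  rewrite negb_and -!ltNge => zs.
  have [e e0 He] : exists2 e, 0 < e & forall z', nrm (z' - z) < e ->
      ~ (s1 <= nrm z' <= s2).
    case/orP: zs => zs.
      exists (s1 - nrm z); rewrite ?subr_gt0 // => z' zz' /andP[s1z' _].
      have := nrmD (z' - z) z; rewrite subrK; lra.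
    exists (nrm z - s2); rewrite ?subr_gt0 // => z' zz' /andP[_ z's2].
    have := nrmD (z - z') z'; rewrite subrK nrmB; lra.
  exists (ball p (e / 2), [set: R]); first split => /=.
  - by apply/nbhs_ballP; exists (e / 2) => //=; rewrite divr_gt0.
  - exact: filterT.
  - by move=> [q B'] [/= pq _] /(He _ (dist _ _ _ e0 pq)).
rewrite ltrDl ltr01 => /(_ isT) KP; exists (B + 1) => z zs.
have := KP (complex.Re z, complex.Im z); rewrite /P /=.
have -> : complex.Re z +i* complex.Im z = z by case: (z).
apply => //; have /andP[_ zs2] := zs; have := Re_le_nrmc z; have := Im_le_nrmc z.
by split => /=; rewrite in_itv /= -ler_norml; exact: le_trans zs2.
Qed.

Section Ideals.
Context {R : realType} {D : normedComAlg R[i]}.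
Implicit Types (x y : D) (z : R[i]).

Definition ideal (I : set D) :=
  [/\ I 0, forall x y, I x -> I y -> I (x + y) & forall x y, I x -> I (x * y)].

(** A bound on the norm of the class of [x] in [D / I]. Representatives in [D]
    stand for the elements of the quotient, and membership of a difference in [I]
    for their equality. *)
Definition qnorm_le (I : set D) x (e : R) := exists2 i, I i & nrm (x + i) <= e.

Context (I : set D).
Hypothesis I_ideal : ideal I.

Lemma ideal0 : I 0. Proof. by case: I_ideal. Qed.
Lemma idealD x y : I x -> I y -> I (x + y). Proof. by case: I_ideal => _ + _; apply. Qed.
Lemma idealM x y : I x -> I (x * y). Proof. by case: I_ideal => _ _; apply. Qed.
Lemma idealN x : I x -> I (- x).
Proof. by move=> Ix; rewrite -mulrN1; exact: idealM. Qed.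
Lemma idealB x y : I x -> I y -> I (x - y).
Proof. by move=> Ix Iy; apply/idealD/idealN. Qed.
Lemma idealZ z x : I x -> I (z *: x).
Proof. by move=> Ix; rewrite -[x]mulr1 scalerAr; exact: idealM. Qed.

Lemma qnorm_le_nrm x e : nrm x <= e -> qnorm_le I x e.
Proof. by exists 0; rewrite ?addr0 //; exact: ideal0. Qed.

Lemma qnorm_le_trans x e e' : e <= e' -> qnorm_le I x e -> qnorm_le I x e'.
Proof. by move=> ee' [i Ii xi]; exists i => //; exact: le_trans ee'. Qed.

Lemma qnorm_le_congr x y e : I (x - y) -> qnorm_le I x e -> qnorm_le I y e.
Proof.
move=> xy [i Ii xi]; exists (x - y + i); first exact: idealD.
by rewrite addrA addrCA subrr addr0.
Qed.

Lemma qnorm_leD x y e e' : qnorm_le I x e -> qnorm_le I y e' -> qnorm_le I (x + y) (e + e').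
Proof.
move=> [i Ii xi] [i' Ii' xi']; exists (i + i'); first exact: idealD.
by rewrite addrACA (le_trans (nrmD _ _)) // lerD.
Qed.

Lemma qnorm_leN x e : qnorm_le I x e -> qnorm_le I (- x) e.
Proof. by move=> [i Ii xi]; exists (- i); rewrite -?opprD ?nrmN //; exact: idealN. Qed.

Lemma qnorm_leZ z x e : qnorm_le I x e -> qnorm_le I (z *: x) (nrm z * e).
Proof.
move=> [i Ii xi]; exists (z *: i); first exact: idealZ.
by rewrite -scalerDr nrmZ ler_wpM2l // nrm_ge0.
Qed.

Lemma qnorm_leM x y e e' : qnorm_le I x e -> qnorm_le I y e' -> qnorm_le I (x * y) (e * e').
Proof.
move=> [i Ii xi] [i' Ii' xi']; exists (i * y + (x + i) * i').
  by apply: idealD; [exact: idealM|rewrite mulrC; exact: idealM].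
rewrite addrA -mulrDl -mulrDr (le_trans (nrmM _ _)) //.
by apply: ler_pM => //; exact: nrm_ge0.
Qed.

End Ideals.

Section Resolvent.
Context {R : realType} {D : normedComAlg R[i]}.
Hypothesis D_complete : complete_algebra D.
Context (I : set D).
Hypothesis I_ideal : ideal I.
Implicit Types (x y a b : D) (z : R[i]).

(** An element of [I] at distance less than [1] from [1] is invertible. *)
Lemma qnorm_le_1 e : e < 1 -> qnorm_le I 1 e -> I 1.
Proof.
move=> e1 [i Ii hi]; have [|y _ hy] := @neumann _ _ D_complete (1 + i).
  exact: le_lt_trans e1.
by rewrite -hy opprD addrA subrr sub0r mulNr; apply: idealN => //; exact: idealM.
Qed.

(** Moving [z] slightly changes [(1 - z *: a) * b] by an element of norm at most
    [1 / 2], so that [b] can be corrected by the inverse of an element [1 - x]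
    with [nrm x <= 1 / 2]. *)
Lemma resolvent_locally_bounded a z b : I ((1 - z *: a) * b - 1) ->
  exists B, exists2 e, 0 < e & forall z', nrm (z' - z) < e ->
    exists2 b', nrm b' <= B & I ((1 - z' *: a) * b' - 1).
Proof.
move=> zb; pose c := nrm (a * b) + 1; have c0 : 0 < c by rewrite ltr_wpDl ?nrm_ge0.
exists (nrm b * (nrm (1 : D) * 2)); exists (1 / (2 * c)); first by rewrite divr_gt0 ?mulr_gt0.
move=> z' zz'; pose x := (z' - z) *: (a * b).
have x2 : nrm x <= 1 / 2.
  have -> : 1 / 2 = 1 / (2 * c) * c by field; rewrite gt_eqF.
  by rewrite /x nrmZ ler_pM ?nrm_ge0 // ?lerDl // ltW.
have [|y yB yE] := @neumann _ _ D_complete x; first by lra.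
exists (b * y).
  rewrite (le_trans (nrmM _ _)) // ler_wpM2l ?nrm_ge0 // (le_trans yB) //.
  by rewrite ler_wpM2l ?nrm_ge0 // invf_ple ?posrE; lra.
suff -> : (1 - z' *: a) * (b * y) - 1 = ((1 - z *: a) * b - 1) * y by exact: idealM.
rewrite -[X in _ - X = _]yE /x scalerAl scalerBl; move: (z *: a) (z' *: a) => u u'; ring.
Qed.

Lemma resolvent_bounded a s1 s2 :
  (forall z, s1 <= nrm z <= s2 -> exists b, I ((1 - z *: a) * b - 1)) ->
  exists B, forall z, s1 <= nrm z <= s2 ->
    exists2 b, nrm b <= B & I ((1 - z *: a) * b - 1).
Proof.
move=> inv; apply: (annulus_compact
  (Q := fun B z => exists2 b, nrm b <= B & I ((1 - z *: a) * b - 1))).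
  by move=> B B' z BB' [b bB bE]; exists b => //; exact: le_trans BB'.
by move=> z /inv[b]; exact: resolvent_locally_bounded.
Qed.

Lemma root_of_minus1 n : (0 < n)%N -> exists2 xi : R[i], xi ^+ n = -1 & nrm xi = 1.
Proof.
move=> n0; exists (n.-root (-1)); first by rewrite rootCK.
apply/eqP; rewrite -(@pexpr_eq1 _ _ n) ?nrm_ge0 // -nrmcX rootCK // nrmN nrmc1 //.
Qed.

(** If [(1 - z *: a)^-1] exists modulo [I] for all [z] of modulus [s], the average
    of these inverses over the points [s] times a root of unity of order
    [n = 2 ^ m] is an inverse [E m s] of [1 - (s *: a) ^+ n]. Averaging preserves
    the norm bound and the Lipschitz constant of the resolvent, so [E m s] is
    bounded and Lipschitz in [s] uniformly in [m], although the elements that it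
    inverts are very sensitive to [s]. The average is built by repeated halving
    from [(1 - y ^+ 2)^-1 = ((1 - y)^-1 + (1 + y)^-1) / 2]; the sign change of [y]
    is a rotation of [z] by a root of [-1]. *)
Lemma resolvent_means a s1 s2 :
  (forall z, s1 <= nrm z <= s2 -> exists b, I ((1 - z *: a) * b - 1)) -> 0 <= s1 ->
  exists B L (E : nat -> R -> D), [/\ 0 <= B, 0 <= L,
    forall m s, s1 <= s <= s2 -> nrm (E m s) <= B /\
       I ((1 - (s%:C *: a) ^+ (2 ^ m)) * E m s - 1) &
    forall m s s', s1 <= s <= s2 -> s1 <= s' <= s2 ->
       qnorm_le I (E m s - E m s') (`|s - s'| * L)].
Proof.
move=> /resolvent_bounded[B0 inv] s10.
pose B := `|B0|.
have /choice[b hb] : forall z, exists b, s1 <= nrm z <= s2 ->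
    nrm b <= B /\ I ((1 - z *: a) * b - 1).
  move=> z; have [/inv[b bB bE]|_] := boolP (s1 <= nrm z <= s2).
    by exists b => _; split => //; rewrite (le_trans bB) // ler_norm.
  by exists 0.
have /choice[xi hxi] m : exists xi : R[i], xi ^+ (2 ^ m) = -1 /\ nrm xi = 1.
  by have [|xi ? ?] := @root_of_minus1 (2 ^ m); [rewrite expn_gt0|exists xi].
pose E := fix E m z := if m is m'.+1 then
   (2^-1 : R[i]) *: (E m' z + E m' (xi m' * z)) else b z.
have half x y e : nrm x <= e -> nrm y <= e -> nrm ((2^-1 : R[i]) *: (x + y)) <= e.
  move=> xe ye; rewrite nrmZ nrmcV (nrmc_nat 2).
  by have := nrmD x y; lra.
have nxi m z : nrm (xi m * z) = nrm z by rewrite nrmcM (hxi m).2 mul1r.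
have EB m z : s1 <= nrm z <= s2 -> nrm (E m z) <= B.
  elim: m z => [|m IH] z zs; first by have [] := hb z zs.
  by apply: half; apply: IH; rewrite ?nxi.
have EI m z : s1 <= nrm z <= s2 -> I ((1 - (z *: a) ^+ (2 ^ m)) * E m z - 1).
  elim: m z => [|m IH] z zs; first by rewrite expn0 expr1; have [] := hb z zs.
  rewrite /= expnSr exprM; set y := (z *: a) ^+ (2 ^ m).
  have := IH (xi m * z); rewrite nxi => /(_ zs).
  rewrite -scalerA exprZn (hxi m).1 scaleN1r -/y opprK => h1.
  have := IH z zs; rewrite -/y => h2.
  have -> : (1 - y ^+ 2) * ((2^-1 : R[i]) *: (E m z + E m (xi m * z))) - 1 =
     (2^-1 : R[i]) *: ((1 + y) * ((1 - y) * E m z - 1) +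
        (1 - y) * ((1 + y) * E m (xi m * z) - 1)).
    have half1 : 1 = (2^-1 : R[i]) *: (1 + 1) :> D by rewrite scalerDr half_scaler.
    by rewrite -scalerAr [in LHS]half1 -scalerBr -half1; congr (_ *: _); ring.
  by apply: idealZ => //; apply: idealD => //; rewrite mulrC; exact: idealM.
pose L := nrm a * (B * B).
have L0 : 0 <= L by rewrite !mulr_ge0 ?nrm_ge0 ?normr_ge0.
have EL m (s s' : R) u : nrm u = 1 -> s1 <= s <= s2 -> s1 <= s' <= s2 ->
    qnorm_le I (E m (s%:C * u) - E m (s'%:C * u)) (`|s - s'| * L).
  move=> + ss ss'; elim: m u => [|m IH] u u1 /=; last first.
    have -> (x y x' y' : D) : (2^-1 : R[i]) *: (x + y) - (2^-1 : R[i]) *: (x' + y') =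
      (2^-1 : R[i]) *: ((x - x') + (y - y')).
      by rewrite -scalerBr opprD addrACA.
    have := IH u u1; have := IH (xi m * u); rewrite nxi => /(_ u1).
    rewrite !(mulrCA (xi m)) => h1 h2.
    apply: qnorm_le_trans (qnorm_leZ I_ideal _ (qnorm_leD I_ideal h2 h1)).
    rewrite nrmcV (nrmc_nat 2); lra.
  have s0 : 0 <= s by case/andP: ss => + _; exact: le_trans.
  have s'0 : 0 <= s' by case/andP: ss' => + _; exact: le_trans.
  have n1 : nrm (s%:C * u) = s by rewrite nrmcM u1 mulr1 nrm_real.
  have n2 : nrm (s'%:C * u) = s' by rewrite nrmcM u1 mulr1 nrm_real.
  have [] := hb (s%:C * u); rewrite ?n1 // => b1B b1I.
  have [] := hb (s'%:C * u); rewrite ?n2 // => b2B b2I.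
  move: n1 n2 b1B b1I b2B b2I.
  set z1 := s%:C * u; set z2 := s'%:C * u => n1 n2 b1B b1I b2B b2I.
  (* the resolvent identity *)
  apply: (@qnorm_le_congr _ _ _ I_ideal ((z1 - z2) *: (a * (b z1 * b z2)))).
    have -> : (z1 - z2) *: (a * (b z1 * b z2)) - (b z1 - b z2) =
      b z1 * ((1 - z2 *: a) * b z2 - 1) - b z2 * ((1 - z1 *: a) * b z1 - 1).
      rewrite scalerAl scalerBl; move: (z1 *: a) (z2 *: a) => *; ring.
    by apply: idealB => //; rewrite mulrC; exact: idealM.
  apply: qnorm_le_nrm => //; rewrite nrmZ ler_pM ?nrm_ge0 //.
    rewrite -mulrBl nrmcM u1 mulr1 -rmorphB /= -lecR nrmE.
    by rewrite normc_def /= lecR expr0n addr0 sqrtr_sqr.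
  rewrite (le_trans (nrmM _ _)) // ler_wpM2l ?nrm_ge0 // (le_trans (nrmM _ _)) //.
  by rewrite ler_pM ?nrm_ge0.
exists B, L, (fun m s => E m s%:C); split; rewrite ?normr_ge0 //.
  move=> m s /[dup] ss /andP[s1s _]; have ns : nrm s%:C = s by rewrite nrm_real // (le_trans s10).
  by split; [apply: EB|apply: EI]; rewrite ns.
by move=> m s s' ss ss'; rewrite -[s%:C]mulr1 -[s'%:C]mulr1; apply: EL => //; exact: nrmc1.
Qed.

End Resolvent.

(** * The Gelfand-Mazur theorem and inverses modulo an ideal *)
Section CharacterAlgebra.
Context {K : numFieldType} {A : normedComAlg K} (phi : character A).
Implicit Types (x y : A) (z : K).

Lemma character0 : phi 0 = 0 :> K. Proof. exact: (raddf0 phi). Qed.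
Lemma character1 : phi 1 = 1 :> K. Proof. exact: (rmorph1 phi). Qed.
Lemma characterD x y : phi (x + y) = (phi x : K) + phi y :> K.
Proof. exact: (raddfD phi). Qed.
Lemma characterB x y : phi (x - y) = (phi x : K) - phi y :> K.
Proof. exact: (raddfB phi). Qed.
Lemma characterM x y : phi (x * y) = (phi x : K) * phi y :> K.
Proof. exact: (rmorphM phi). Qed.
Lemma characterZ z x : phi (z *: x) = z * phi x :> K.
Proof. exact: (linearZ_LR phi). Qed.
Lemma characterX x n : phi (x ^+ n) = (phi x : K) ^+ n :> K.
Proof. exact: (rmorphXn phi). Qed.

Definition kills (I : set A) := forall x, I x -> phi x = 0.
End CharacterAlgebra.

Lemma exp2_small {R : realType} (r C e : R) : 0 <= r < 1 -> 0 < e ->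
  exists N, forall m, (N <= m)%N -> r ^+ (2 ^ m) * C <= e.
Proof.
move=> /andP[r0 r1] e0.
have : (fun n => r ^+ n * C) @ \oo --> (0 * C : R).
  by apply: cvgMl; apply: cvg_expr; rewrite ger0_norm.
rewrite mul0r => /cvgrPdist_le /(_ e e0)[N _ hN]; exists N => m Nm.
have := hN (2 ^ m)%N; rewrite sub0r normrN => h.
apply: le_trans (h _); first exact: ler_norm.
exact/(leq_trans Nm)/ltnW/ltn_expl.
Qed.

Section GelfandMazur.
Context {R : realType} {D : normedComAlg R[i]}.
Hypothesis D_complete : complete_algebra D.
Implicit Types (x y a b : D) (z : R[i]).

(** This is Rickart's elementary proof of the spectral radius formula. Let [E m s]
    be the inverse of [1 - (s *: a) ^+ (2 ^ m)] from [resolvent_means]. If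
    [(s *: a) ^+ (2 ^ m)] tends to [0], then [E m s] tends to [1]; as [E m] is
    Lipschitz uniformly in [m], [E m (s + d)] stays at distance at most [1 / 2]
    from [1] for a step [d] that depends neither on [s] nor on [m]. Hence
    [((s + d) *: a) ^+ (2 ^ m)] is bounded, and the powers at any smaller parameter
    tend to [0]. Finitely many steps of length [d / 2] reach every [s]. *)
Lemma rickart (I : set D) a : ideal I ->
  (forall z, exists b, I ((1 - z *: a) * b - 1)) ->
  forall s : R, 0 <= s -> forall e, 0 < e ->
    exists N, forall m, (N <= m)%N -> qnorm_le I ((s%:C *: a) ^+ (2 ^ m)) e.
Proof.
move=> I_ideal inv s s0.
have [|//|B [L [E [B0 L0 EI EL]]]] :=
  @resolvent_means _ _ D_complete I I_ideal a 0 (s + 1); first by move=> z _.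
pose null t := forall e, 0 < e ->
    exists N, forall m, (N <= m)%N -> qnorm_le I ((t%:C *: a) ^+ (2 ^ m)) e.
have shrink t t' C : 0 <= t' < t ->
    (exists N, forall m, (N <= m)%N -> qnorm_le I ((t%:C *: a) ^+ (2 ^ m)) C) -> null t'.
  move=> /andP[t'0 t't] [N hN] e e0; have t0 : 0 < t := le_lt_trans t'0 t't.
  have [|N' hN'] := @exp2_small _ (t' / t) C e _ e0.
    by rewrite divr_ge0 ?(ltW t0) //= ltr_pdivrMr // mul1r.
  exists (maxn N N') => m; rewrite geq_max => /andP[/hN h1 /hN' h2].
  have -> : t'%:C *: a = (t' / t)%:C *: (t%:C *: a).
    by rewrite scalerA -rmorphM /= divfK // gt_eqF.
  rewrite exprZn; apply: qnorm_le_trans h2 _.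
  have -> : (t' / t) ^+ (2 ^ m) = nrm ((t' / t)%:C ^+ (2 ^ m)).
    by rewrite nrmcX nrm_real // divr_ge0 // ltW.
  exact: qnorm_leZ.
have null_le t t' : 0 <= t' <= t -> null t -> null t'.
  move=> /andP[t'0]; rewrite le_eqVlt => /predU1P[->//|t't] h.
  by apply: (@shrink t t' 1); [rewrite t'0|exact: h].
pose d := 1 / (4 * (L + 1)).
have d0 : 0 < d by rewrite divr_gt0 ?mulr_gt0 // ltr_wpDl.
have d4 : 4 * (d * (L + 1)) = 1 by rewrite /d; field; rewrite gt_eqF // ltr_wpDl.
have step t : 0 <= t -> t <= s -> null t -> null (t + d / 2).
  move=> t0 ts tnull; apply: (@shrink (t + d) _ (nrm (1 : D))); first by lra.
  have e0 : 0 < 1 / (4 * (B + 1)) by rewrite divr_gt0 ?mulr_gt0 // ltr_wpDl.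
  have eB : 1 / (4 * (B + 1)) * B <= 1 / 4.
    rewrite mulrAC ler_pdivrMr ?mulr_gt0 ?ltr_wpDl //; lra.
  have [N hN] := tnull _ e0; exists N => m /hN {hN}yt.
  have td : 0 <= t <= s + 1 by lra.
  have t'd : 0 <= t + d <= s + 1 by have := ler_wpM2l (ltW d0) L0; lra.
  have [EB Et] := EI m t td; have [_ Et'] := EI m (t + d) t'd.
  have := EL m (t + d) t t'd td.
  rewrite [t + d]addrC addrK [`|d|]ger0_norm ?(ltW d0) // [d + t]addrC => Ett'.
  move: yt Et Et' EB Ett'; set y := (t%:C *: a) ^+ _; set y' := (_ *: a) ^+ _.
  set w := E m t; set w' := E m (t + d) => yt Et Et' EB Ett'.
  have : qnorm_le I (w - 1) (1 / 4).
    apply: (@qnorm_le_congr _ _ _ I_ideal (y * w)).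
      have -> : y * w - (w - 1) = - ((1 - y) * w - 1) by ring.
      exact: idealN.
    apply: qnorm_le_trans eB _; apply: qnorm_leM => //; exact: qnorm_le_nrm.
  move=> /(qnorm_leD I_ideal Ett'); rewrite subrKA => -[i Ii hi].
  pose h := - (w' - 1 + i).
  have h2 : nrm h <= 1 / 2 by rewrite nrmN; apply: (le_trans hi); nra.
  have [|g gB gE] := @neumann _ _ D_complete h; first by lra.
  apply: (@qnorm_le_congr _ _ _ I_ideal (- (h * g))).
    have -> : - (h * g) - y' = (((1 - y') * w' - 1) + i * (1 - y')) * g.
      rewrite -[in LHS](mulr1 y') -[in LHS]gE /h; ring.
    by apply: idealM => //; apply: idealD => //; exact: idealM.
  apply: qnorm_le_nrm => //; rewrite nrmN (le_trans (nrmM _ _)) //.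
  have : nrm g <= nrm (1 : D) * 2.
    rewrite (le_trans gB) // ler_wpM2l ?nrm_ge0 // invf_ple ?posrE; lra.
  have := nrm_ge0 h; have := nrm_ge0 g; nra.
(* the cap at [s] keeps [t + d] inside the interval where the resolvent is bounded *)
have iter_null k : null (Num.min s (k%:R * (d / 2))).
  elim: k => [|k IH].
    rewrite mul0r min_r // => e e0; exists 0%N => m _.
    by rewrite scale0r expr0n expn_eq0 /=; apply: qnorm_le_nrm; rewrite ?nrm0 // ltW.
  have kd : 0 <= k%:R * (d / 2) by rewrite mulr_ge0 // ltW // divr_gt0.
  have := step _ _ _ IH; rewrite le_min s0 kd ge_min lexx => /(_ isT isT).
  have d20 : 0 <= d / 2 by rewrite ltW // divr_gt0.
  apply: null_le; rewrite -natr1 mulrDl mul1r; apply/andP; split.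
    by rewrite le_min s0 addr_ge0.
  by rewrite addr_minl le_min !ge_min lexx orbT andbT lerDl d20.
have [k hk] : exists k : nat, s <= k%:R * (d / 2).
  have d20 : 0 < d / 2 by rewrite divr_gt0.
  exists (Num.bound (s / (d / 2))); rewrite -ler_pdivrMr //.
  by apply/ltW/archi_boundP; rewrite divr_ge0 // ltW.
by have := iter_null k; rewrite min_l.
Qed.

(** If no [a - z *: 1] were in [M], all [1 - z *: a] would be invertible modulo [M],
    so [(s *: a) ^+ n] would be small for all [s]. With [c] an inverse of [a]
    modulo [M] and [s] larger than [2 * nrm c], the product of [(s *: a) ^+ n] and
    [(s^-1 *: c) ^+ n] is small too, but it is [1] modulo [M]. *)
Lemma gelfand_mazur (M : set D) : ideal M -> ~ M 1 ->
  (forall x, ~ M x -> exists b, M (x * b - 1)) ->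
  forall a, exists z, M (a - z *: 1).
Proof.
move=> M_ideal M1 M_max a; apply: contrapT => /forallNP az.
have inv z : exists b, M ((1 - z *: a) * b - 1).
  have [->|z0] := eqVneq z 0.
    by exists 1; rewrite scale0r subr0 mulr1 subrr; exact: ideal0.
  have [b bE] := M_max _ (az z^-1); exists ((- z^-1) *: b).
  suff -> : (1 - z *: a) * (- z^-1 *: b) = (a - z^-1 *: 1) * b by [].
  rewrite -scalerAr scalerAl; congr (_ * _).
  by rewrite scalerBr !scaleNr scalerA mulVf // scale1r opprK addrC.
have [c cE] : exists c, M (a * c - 1).
  by apply: M_max; have := az 0; rewrite scale0r subr0.
pose s := 2 * nrm c + 1.
have s0 : 0 < s by rewrite ltr_wpDl // mulr_ge0 ?nrm_ge0.
have [N1 hN1] := @rickart M a M_ideal inv s (ltW s0) 1 ltr01.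
have [||N2 hN2] := @exp2_small _ (nrm c / s) (nrm (1 : D)) (1 / 2).
- by rewrite divr_ge0 ?nrm_ge0 ?(ltW s0) //= ltr_pdivrMr // mul1r /s; have := nrm_ge0 c; lra.
- by [].
have := hN2 _ (leq_maxr N1 N2); have := hN1 _ (leq_maxl N1 N2).
set n := (2 ^ _)%N => h1 h2; apply: M1.
apply: (@qnorm_le_1 _ _ D_complete _ M_ideal (1 / 2)); first by lra.
apply: (@qnorm_le_congr _ _ _ M_ideal ((s%:C *: a) ^+ n * ((s^-1)%:C *: c) ^+ n)).
  rewrite -exprMn -scalerAl -scalerAr scalerA -rmorphM /= divff ?gt_eqF // scale1r.
  rewrite -[X in _ - X](expr1n _ n) subrXX; exact: idealM.
apply: (@qnorm_le_trans _ _ _ _ (1 * (1 / 2))); first by rewrite mul1r.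
apply: qnorm_leM => //; apply: qnorm_le_nrm => //.
apply: le_trans h2; rewrite mulrC (le_trans (nrmX _ _)) // nrmZ nrm_real ?invr_ge0 ?(ltW s0) //.
by rewrite [_^-1 * _]mulrC.
Qed.

(** Otherwise [1 - (phi x)^-1 *: x] would be invertible and in the kernel of [phi]. *)
Lemma nrm_character (phi : character D) x : nrm (phi x : R[i]) <= nrm x.
Proof.
rewrite leNgt; apply/negP => h; set z : R[i] := phi x in h.
have z0 : z != 0 by rewrite -nrmc_eq0 gt_eqF // (le_lt_trans (nrm_ge0 x)).
have [|y _ yE] := @neumann _ _ D_complete (z^-1 *: x).
  by rewrite nrmZ nrmcV mulrC ltr_pdivrMr ?mul1r // (le_lt_trans (nrm_ge0 x)).
have : phi 1 = 0.
  by rewrite -yE characterM characterB characterZ character1 mulVf // subrr mul0r.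
by rewrite character1 => /eqP; rewrite oner_eq0.
Qed.

Lemma character_of (f : D -> R[i]) :
  (forall x y, f (x + y) = f x + f y) -> (forall x y, f (x * y) = f x * f y) ->
  (forall z x, f (z *: x) = z * f x) -> f 1 = 1 ->
  (forall x, nrm (f x) <= nrm x) -> exists phi : character D, forall x, phi x = f x.
Proof.
move=> fD fM fZ f1 f_le.
pose g : D -> R[i]^o := f.
pose gl := GRing.isLinear.Build R[i] D R[i]^o _ g
  (fun k u v => etrans (fD _ _) (congr1 (+%R^~ _) (fZ k u))).
pose gm := GRing.isMonoidMorphism.Build D R[i]^o g (conj f1 fM).
pose g' : {lrmorphism D -> R[i]^o} := HB.pack g gl gm.
have gc : continuous g'.
  move=> x U /nbhs_ballP[e e0 eU]; apply/nbhs_ballP; exists e => // t xt.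
  apply: eU; move: xt; rewrite -!ball_normE /= => xt.
  have -> : g' x - g' t = f (x - t) by rewrite -(rmorphB g').
  by rewrite -nrmE; apply: le_lt_trans xt; rewrite -nrmE lecR.
by exists (Character gc).
Qed.

Lemma maximal_ideal (I : set D) : ideal I -> ~ I 1 ->
  exists M, [/\ ideal M, I `<=` M, ~ M 1 & forall x, ~ M x -> exists b, M (x * b - 1)].
Proof.
move=> I_ideal I1.
(* the union with [I] makes the empty chain harmless *)
pose P (X : set D) := ideal (I `|` X) /\ ~ (I `|` X) 1.
have [|X [[IX X1] Xmax]] := @Zorn_bigcup D P.
  move=> F FP Ftot.
  have cover x y : (I `|` \bigcup_(X in F) X) x -> (I `|` \bigcup_(X in F) X) y ->
      exists X, [/\ (X = set0 \/ F X), (I `|` X) x & (I `|` X) y].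
    move=> [Ix|[X FX Xx]] [Iy|[Y FY Yy]].
    - by exists set0; split; left.
    - by exists Y; split; [right|left|right].
    - by exists X; split; [right|right|left].
    - have [XY|YX] := Ftot X Y FX FY.
        by exists Y; split; [right|right; exact: XY|right].
      by exists X; split; [right|right|right; exact: YX].
  have P0 X : X = set0 \/ F X -> P X.
    by move=> [->|/FP //]; rewrite /P setU0.
  have sub X : X = set0 \/ F X -> I `|` X `<=` I `|` \bigcup_(X in F) X.
    by move=> [->|FX] x []; [left|by []|left|right; exists X].
  split; last by move=> h; have [X [/P0[_ X1] /X1]] := cover _ _ h h.
  split; first by left; exact: ideal0.
    move=> x y hx hy; have [X [FX Xx Xy]] := cover _ _ hx hy.
    by have [iX _] := P0 _ FX; apply: (sub _ FX); exact: idealD.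
  move=> x y hx; have [X [FX Xx _]] := cover _ _ hx hx.
  by have [iX _] := P0 _ FX; apply: (sub _ FX); exact: idealM.
exists (I `|` X); split => // x Mx.
pose Y := [set y | exists2 u, (I `|` X) u & exists v, y = u + x * v].
have XY : I `|` X `<=` Y by move=> u Xu; exists u => //; exists 0; rewrite mulr0 addr0.
have Yx : Y x by exists 0; [exact: ideal0|exists 1; rewrite mulr1 add0r].
have IY : I `|` Y = Y by apply/setUidr => u Iu; apply: XY; left.
have Yideal : ideal Y.
  split; first by apply: XY; exact: ideal0.
    move=> _ _ [u Xu [v ->]] [u' Xu' [v' ->]]; exists (u + u'); first exact: idealD.
    by exists (v + v'); ring.
  move=> _ y [u Xu [v ->]]; exists (u * y); first exact: idealM.
  by exists (v * y); ring.
apply: contrapT => nb; apply: (Xmax Y).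
  split; first by move=> u Xu; apply: XY; right.
  by move=> /(_ x Yx) Xx; apply: Mx; right.
rewrite /P IY; split => // -[u Xu [v uv]]; apply: nb; exists v.
have -> : x * v - 1 = - u by rewrite uv; ring.
exact: idealN.
Qed.

(** The characters killing [I] are those of [D / I]. If [d] has no inverse modulo
    [I], then [I] and [d] lie in a maximal ideal [M], and by [gelfand_mazur] the
    quotient [D / M] consists of scalars: it gives a character killing [I] and [d]. *)
Lemma gelfand_invertible (I : set D) d : ideal I ->
  (forall phi : character D, kills phi I -> phi d != 0) ->
  exists b, I (d * b - 1).
Proof.
move=> I_ideal dn0; apply: contrapT => nb.
pose J := [set y | exists2 u, I u & exists v, y = u + d * v].
have J_ideal : ideal J.
  split; first by exists 0; [exact: ideal0|exists 0; ring].
    move=> _ _ [u Iu [v ->]] [u' Iu' [v' ->]]; exists (u + u'); first exact: idealD.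
    by exists (v + v'); ring.
  move=> _ y [u Iu [v ->]]; exists (u * y); first exact: idealM.
  by exists (v * y); ring.
have J1 : ~ J 1.
  move=> [u Iu [v uv]]; apply: nb; exists v.
  have -> : d * v - 1 = - u by rewrite uv; ring.
  exact: idealN.
have [M [M_ideal JM M1 Mmax]] := maximal_ideal J_ideal J1.
have /choice[f fM] := gelfand_mazur M_ideal M1 Mmax.
have M_scal z : M (z *: 1) -> z = 0.
  move=> Mz; apply/eqP; apply: contrapT => /negP z0; apply: M1.
  have -> : 1 = z^-1 *: (z *: 1) :> D by rewrite scalerA mulVf // scale1r.
  exact: idealZ.
have f_uniq x z : M (x - z *: 1) -> f x = z.
  move=> xz; apply/eqP; rewrite -subr_eq0; apply/eqP/M_scal.
  have -> : (f x - z) *: 1 = (x - z *: 1) - (x - f x *: 1) :> D.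
    by rewrite scalerBl; ring.
  exact: idealB.
have [|||||phi phiE] := @character_of f.
- move=> x y; apply: f_uniq.
  have -> : x + y - (f x + f y) *: 1 = (x - f x *: 1) + (y - f y *: 1).
    by rewrite scalerDl; ring.
  exact: idealD.
- move=> x y; apply: f_uniq.
  have -> : x * y - (f x * f y) *: 1 = (x - f x *: 1) * y + (y - f y *: 1) * (f x *: 1).
    by rewrite -scalerA -[in LHS](mul1r (f y *: 1)) scalerAl; ring.
  by apply: idealD => //; exact: idealM.
- move=> z x; apply: f_uniq.
  by rewrite -scalerA -scalerBr; exact: idealZ.
- by apply: f_uniq; rewrite scale1r subrr; exact: ideal0.
- move=> x; rewrite leNgt; apply/negP => h; have n0 := le_lt_trans (nrm_ge0 x) h.
  have f0 : f x != 0 by rewrite -nrmc_eq0 gt_eqF.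
  have [|y _ yE] := @neumann _ _ D_complete ((f x)^-1 *: x).
    by rewrite nrmZ nrmcV mulrC ltr_pdivrMr ?mul1r.
  apply: M1; rewrite -yE; apply: idealM => //.
  have -> : 1 - (f x)^-1 *: x = - (f x)^-1 *: (x - f x *: 1).
    by rewrite scalerBr !scaleNr scalerA mulVf // scale1r opprK addrC.
  exact: idealZ.
have MI x : I x -> phi x = 0.
  move=> Ix; rewrite phiE; apply: f_uniq; rewrite scale0r subr0; apply: JM.
  by exists x => //; exists 0; ring.
have /eqP := dn0 _ MI; apply; rewrite phiE; apply: f_uniq; rewrite scale0r subr0; apply: JM.
by exists 0; [exact: ideal0|exists 1; ring].
Qed.

End GelfandMazur.

(** * Idempotents from a gap in the spectrum *)
Section Idempotents.
Context {R : realType} {D : normedComAlg R[i]}.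
Hypothesis D_complete : complete_algebra D.
Implicit Types (x y a b : D) (z : R[i]).

(** With [u t] short for the inverse of [1 - (t *: a) ^+ (2 ^ m)], the resolvent
    identity gives [u t * u t' - u t' -> 0] for [t < t'] as [m] grows: the Gelfand
    transforms of [u t] and [u t'] both tend to the indicator function of the inner
    part of the spectrum. Thus for [t < s < t'] the product
    [(u t - u s) * (u s - u t')] is [u s - u s * u s] up to a small error, and it
    is small when [t] and [t'] are close to [s], since [u] is Lipschitz uniformly
    in [m]. *)
Lemma approximate_idempotent (I : set D) a s1 s2 : ideal I -> 0 <= s1 -> s1 < s2 ->
  (forall z, s1 <= nrm z <= s2 -> exists b, I ((1 - z *: a) * b - 1)) ->
  exists N, forall m, (N <= m)%N -> exists2 u,
    I ((1 - (((s1 + s2) / 2)%:C *: a) ^+ (2 ^ m)) * u - 1) &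
    qnorm_le I (u * u - u) (1 / 16).
Proof.
move=> I_ideal s10 s12 inv; set s := (s1 + s2) / 2.
have [B [L [E [B0 L0 EI EL]]]] := resolvent_means D_complete I_ideal inv s10.
pose d := Num.min ((s2 - s1) / 2) (1 / (8 * (L + 1))).
have d0 : 0 < d by rewrite lt_min !divr_gt0 ?subr_gt0 ?mulr_gt0 // ltr_wpDl.
have ds : d <= (s2 - s1) / 2 by rewrite ge_min lexx.
have dL : d * L <= 1 / 8.
  have : d <= 1 / (8 * (L + 1)) by rewrite ge_min lexx orbT.
  rewrite ler_pdivlMr ?mulr_gt0 ?ltr_wpDl //; nra.
(* this bounds [(u t' - 1) * u t] *)
pose C := (B + nrm (1 : D)) * B.
have C0 : 0 <= C by rewrite mulr_ge0 // addr_ge0 // nrm_ge0.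
have absorb t t' : s1 <= t -> t < t' -> t' <= s2 -> exists N, forall m, (N <= m)%N ->
    qnorm_le I (E m t * E m t' - E m t') (1 / 64).
  move=> s1t tt' t's2.
  have t0 : 0 <= t := le_trans s10 s1t; have t'0 : 0 < t' := le_lt_trans t0 tt'.
  have [||N hN] := @exp2_small _ (t / t') C (1 / 64); [|lra|].
    by rewrite divr_ge0 ?(ltW t'0) //= ltr_pdivrMr // mul1r.
  exists N => m /hN{hN}h.
  have ts : s1 <= t <= s2 by lra. have t's : s1 <= t' <= s2 by lra.
  have [uB uE] := EI m t ts; have [u'B u'E] := EI m t' t's.
  move: uB uE u'B u'E; set u := E m t; set u' := E m t'.
  have -> : t%:C *: a = (t / t')%:C *: (t'%:C *: a).
    by rewrite scalerA -rmorphM /= divfK // gt_eqF.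
  rewrite exprZn; set y := (t'%:C *: a) ^+ _; set r := (_%:C ^+ _) => uB uE u'B u'E.
  apply: (@qnorm_le_congr _ _ _ I_ideal (r *: ((u' - 1) * u))).
    have -> : r *: ((u' - 1) * u) - (u * u' - u') =
        r *: (((1 - y) * u' - 1) * u) - ((1 - r *: y) * u - 1) * u'.
      have [k kE] : exists k, forall x, r *: x = k * x.
        by exists r%:A => x; rewrite mulr_algl.
      by rewrite !kE; ring.
    by apply: idealB => //; [apply: idealZ => //|]; exact: idealM.
  apply: qnorm_le_nrm => //; apply: le_trans h; rewrite nrmZ.
  have -> : nrm r = (t / t') ^+ (2 ^ m) by rewrite nrmcX nrm_real // divr_ge0 // ltW.
  rewrite ler_wpM2l ?exprn_ge0 ?divr_ge0 ?(ltW t'0) // (le_trans (nrmM _ _)) //.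
  by rewrite ler_pM ?nrm_ge0 // (le_trans (nrmD _ _)) // nrmN lerD.
have [|||N1 h1] := absorb (s - d) s; rewrite ?/s; [lra|lra|lra|].
have [|||N2 h2] := absorb (s - d) (s + d); rewrite ?/s; [lra|lra|lra|].
have [|||N3 h3] := absorb s (s + d); rewrite ?/s; [lra|lra|lra|].
exists (maxn N1 (maxn N2 N3)) => m; rewrite !geq_max => /and3P[/h1 {}h1 /h2 {}h2 /h3 {}h3].
have ss : s1 <= s <= s2 by rewrite /s; lra.
have sd : s1 <= s - d <= s2 by rewrite /s; lra.
have ds' : s1 <= s + d <= s2 by rewrite /s; lra.
exists (E m s); first by have [] := EI m s ss.
have := EL m _ _ ss ds'; have := EL m _ _ sd ss.
rewrite opprD addrA subrr sub0r !normrN addrAC subrr sub0r normrN.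
rewrite [`|d|]gtr0_norm // => k1 k2.
have := qnorm_leM I_ideal k1 k2; move: h1 h2 h3; rewrite -/s.
set u0 := E m (s - d); set u := E m s; set u2 := E m (s + d) => h1 h2 h3 h4.
have -> : u * u - u = (u0 * u - u) - (u0 * u2 - u2) + (u * u2 - u2) - (u0 - u) * (u - u2) by ring.
apply: (@qnorm_le_trans _ _ _ _ (1 / 64 + 1 / 64 + 1 / 64 + (d * L) * (d * L))); last first.
  apply: qnorm_leD (qnorm_leN _ h4) => //; apply: qnorm_leD h3 => //.
  by apply: qnorm_leD (qnorm_leN _ h2) => //.
have : 0 <= d * L by rewrite mulr_ge0 // ltW.
nra.
Qed.
End Idempotents.

Section Separation.
Context {R : realType} {D : normedComAlg R[i]}.
Hypothesis D_complete : complete_algebra D.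
Implicit Types (x y a b : D) (z : R[i]) (phi : character D).

(** Writing [w = u * u - u], the element [1 / 2 + (u - 1 / 2) / sqrt (1 + 4 w)] is
    idempotent. Only the class of [w] modulo [I] is small, so the square root is
    taken for a small representative [w + i]. The real part of the square root is
    positive, so a character cannot move the value of [u] from near [1] to [0] or
    from near [0] to [1]. *)
Lemma exact_idempotent (I : set D) u : ideal I -> qnorm_le I (u * u - u) (1 / 16) ->
  exists2 e, I (e * e - e) & forall phi, kills phi I ->
    (phi u = 1 -> phi e = 1) /\ (nrm (phi u : R[i]) <= 1 / 4 -> phi e = 0).
Proof.
move=> I_ideal [i Ii hi].
pose v := (- 4 : R[i]) *: (u * u - u + i).
have v4 : nrm v <= 1 / 4.
  by rewrite nrmZ nrmN (nrmc_nat 4); lra.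
have [y [g [y2 yg gv]]] := inv_sqrt D_complete v4.
have [h hE] : exists h : D, h + h = 1.
  by exists ((2^-1 : R[i]) *: 1); exact: half_scaler.
have vE : v = - (u * u - u + i + (u * u - u + i) + (u * u - u + i) + (u * u - u + i)).
  by rewrite /v scaleNr -[4]/(4%:R) scaler_nat !mulrS mulr0n addr0 !addrA.
pose e := h + (u - h) * g.
have eI : I (e * e - e).
  have -> : e * e - e = - (i * g ^+ 2) +
      (h + h - 1) * ((u - h) * g + h - u * g ^+ 2 - (h + h + 1) * (u * u - u + i) * g ^+ 2) +
      h * h * (g ^+ 2 * (1 - v) - 1).
    by rewrite vE /e; ring.
  rewrite hE gv !subrr mul0r mulr0 !addr0.
  by apply: idealN => //; exact: idealM.
exists e => // phi phiI.
pose E : R[i] := phi e; pose c : R[i] := phi u; pose p : R[i] := phi y.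
(* [1 - p] is the value of the square root *)
have Ep : (1 - p) * E + (1 - p) * E = c + c - p.
  have kE : (phi h : R[i]) + phi h = 1 by rewrite -characterD hE character1.
  have qE : (1 - p) * phi g = 1.
    rewrite -[LHS]/((1 - phi y) * phi g : R[i]) -(character1 phi) -characterB.
    by rewrite -characterM yg.
  have -> : E = (phi h : R[i]) + (c - phi h) * phi g.
    by rewrite /E /e characterD characterM characterB.
  move: (phi h : R[i]) (phi g : R[i]) kE qE => k q kE qE.
  have -> : (1 - p) * (k + (c - k) * q) + (1 - p) * (k + (c - k) * q) =
     (k + k) * (1 - p) + (c + c - (k + k)) * ((1 - p) * q) by ring.
  rewrite kE qE; ring.
have p2 : nrm p <= 1 / 2 := le_trans (nrm_character D_complete _ _) y2.
have nrm2 : nrm (1 + 1 : R[i]) = 2.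
  by rewrite (nrmc_nat 2).
have E01 : E = 0 \/ E = 1.
  have : E * E - E = 0 by rewrite /E -characterM -characterB; exact: phiI.
  have -> : E * E - E = E * (E - 1) by ring.
  by move=> /eqP; rewrite mulf_eq0 subr_eq0 => /orP[]/eqP; [left|right].
split=> [c1|c4].
  case: E01 => // E0; move: Ep; rewrite E0 /c c1 mulr0 addr0 => /esym/eqP.
  rewrite subr_eq0 => /eqP pE; move: p2; rewrite -pE nrm2 => h2; exfalso; lra.
case: E01 => // E1; move: Ep; rewrite E1 mulr1 => Ep.
have : 1 + 1 = c + c + p.
  have -> : 1 + 1 = (1 - p) + (1 - p) + p + p by ring.
  rewrite Ep; ring.
move=> /(congr1 nrm); rewrite nrm2.
have := nrmD (c + c) p; have := nrmD c c; rewrite -/c in c4; move=> *; exfalso; lra.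
Qed.

(** No character killing [I] takes [a] into the annulus between the radii [d] and
    [2 * d], so [gelfand_invertible] provides the inverses of [1 - z *: a] for
    [1 / (2 * d) <= nrm z <= 1 / d]. The idempotent of the inner part of the
    spectrum comes from [u = (1 - w)^-1], where [w] is a high power of a multiple
    of [a] of which the characters have modulus at least [3 / 2] on the outer
    part. *)
Lemma separating_idempotent (I : set D) a (d : R) : ideal I -> 0 < d ->
  (forall phi, kills phi I -> ~ (d <= nrm (phi a : R[i]) <= 2 * d)) ->
  exists2 e, I (e * e - e) & forall phi, kills phi I ->
    (phi a = 0 -> phi e = 1) /\ (2 * d <= nrm (phi a : R[i]) -> phi e = 0).
Proof.
move=> I_ideal d0 gap.
have dinv : 1 / d = 2 * (1 / (2 * d)) by field; rewrite gt_eqF.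
have d20 : 0 < 1 / (2 * d) by rewrite divr_gt0 // mulr_gt0.
have inv z : 1 / (2 * d) <= nrm z <= 1 / d -> exists b, I ((1 - z *: a) * b - 1).
  move=> /andP[z1 z2]; apply: gelfand_invertible => // phi /gap; apply: contra_notP.
  move=> /negP; rewrite negbK => /eqP.
  rewrite -[LHS]/(phi (1 - z *: a) : R[i]) characterB characterZ character1.
  move/eqP; rewrite subr_eq0 => /eqP /(congr1 nrm); rewrite nrmc1 nrmcM => zE.
  have z0 : 0 < nrm z := lt_le_trans d20 z1.
  have -> : nrm (phi a : R[i]) = 1 / nrm z by rewrite zE mulrAC divff ?mul1r // gt_eqF.
  move: z1 z2; rewrite !ler_pdivrMr ?ler_pdivlMr ?mulr_gt0 //; lra.
have [||N hN] := approximate_idempotent D_complete I_ideal _ _ inv.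
- exact: ltW.
- rewrite dinv; lra.
have [u uI u16] := hN _ (leq_maxl N 2).
have [e eI eE] := exact_idempotent I_ideal u16; exists e => // phi phiI.
have [e1 e0] := eE phi phiI.
move: uI; set s := (_ / 2); set n := (2 ^ _)%N => uI.
have sE : s = 3 / (4 * d) by rewrite /s; field; rewrite gt_eqF.
have := phiI _ uI; rewrite -[LHS]/(phi _ : R[i]) characterB characterM characterB.
rewrite character1 characterX characterZ => /eqP; rewrite subr_eq0 => /eqP uE.
split=> [a0|a2].
  apply: e1; move: uE; rewrite a0 mulr0 expr0n expn_eq0 /= subr0 mul1r //.
apply: e0; move: uE; set w := (s%:C * _) => uE.
have w32 : 3 / 2 <= nrm w.
  have s0 : 0 <= s by rewrite sE divr_ge0 // mulr_ge0 // ltW.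
  rewrite /w nrmcM nrm_real // sE [leRHS]mulrAC ler_pdivlMr ?mulr_gt0 //; lra.
(* four factors [3 / 2] exceed [5], hence [phi u] has modulus at most [1 / 4] *)
have n4 : (4 <= n)%N by rewrite (@leq_pexp2l 2 2) // leq_maxr.
have w5 : 5 <= nrm (w ^+ n).
  rewrite nrmcX (@le_trans _ _ ((3 / 2) ^+ n)) //; last first.
    by rewrite lerXn2r ?nnegrE ?nrm_ge0 ?divr_ge0.
  rewrite (@le_trans _ _ ((3 / 2) ^+ 4)) //; last by rewrite ler_eXn2l //; lra.
  by rewrite !exprS expr0; lra.
have w4 : 4 <= nrm (1 - w ^+ n).
  have := nrmD (1 - w ^+ n) (- 1); rewrite addrAC subrr sub0r !nrmN nrmc1; lra.
move: uE => /(congr1 nrm); rewrite nrmcM nrmc1.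
have := nrm_ge0 (phi u : R[i]); nra.
Qed.
End Separation.

(** * Separating elements *)
Section SeparatingElements.
Context {R : realType} {D : normedComAlg R[i]}.
Hypothesis D_complete : complete_algebra D.
Implicit Types (x y a b : D) (z : R[i]) (phi w : character D).

(** The algebra is regular exactly when these filters are finer than those of the
    neighbourhoods in the weak-* topology. *)
Definition regular_nbhs (w : character D) : set_system (character D) :=
  [set W | exists2 d : D, w d = 1 & forall phi, ~ W phi -> phi d = 0].

Instance regular_nbhs_filter w : Filter (regular_nbhs w).
Proof.
split.
- by exists 1; [exact: character1|move=> phi []].
- move=> V W [d wd dV] [d' wd' dW]; exists (d * d').
    by rewrite -[LHS]/(w _ : R[i]) characterM wd wd' mulr1.
  move=> phi VW; rewrite -[LHS]/(phi _ : R[i]) characterM.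
  have [Vp|/dV->] := pselect (V phi); last by rewrite mul0r.
  by rewrite dW ?mulr0 // => Wp; apply: VW.
- move=> V W VW [d wd dV]; exists d => // phi Wp; apply: dV => Vp; exact/Wp/VW.
Qed.

(** Since the weak-* topology is that of pointwise convergence, regularity can be
    tested on one element at a time. *)
Definition separating (x : D) := forall w (e : R), 0 < e ->
  regular_nbhs w [set phi | nrm (phi x - w x : R[i]) < e].

(** Characters of a complete algebra are contractive, so a good approximation of
    [x] varies with the character as [x] does. *)
Lemma separating_limit x : (forall e, 0 < e -> exists2 y, separating y & nrm (x - y) <= e) ->
  separating x.
Proof.
move=> x_lim w e e0; have e3 : 0 < e / 4 by rewrite divr_gt0.
have [y ysep xy] := x_lim _ e3.
apply: filterS (ysep w _ e3) => phi /= phiy.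
have -> : phi x - w x = phi (x - y) + (phi y - w y) - w (x - y) :> R[i].
  by rewrite !characterB; ring.
have := nrm_character D_complete phi (x - y); have := nrm_character D_complete w (x - y).
have := nrmD (phi (x - y) + (phi y - w y) : R[i]) (- w (x - y)).
have := nrmD (phi (x - y) : R[i]) (phi y - w y); rewrite nrmN; lra.
Qed.

Lemma root_gap (rs : seq R[i]) z : exists2 d : R, 0 < d &
  forall r, r \in rs -> r != z -> d <= nrm (r - z).
Proof.
elim: rs => [|r rs [d d0 IH]]; first by exists 1.
have [->|rz] := eqVneq r z.
  by exists d => // r'; rewrite inE => /predU1P[->|/IH //]; rewrite eqxx.
exists (Num.min d (nrm (r - z))).
  by rewrite lt_min d0 lt_neqAle nrm_ge0 eq_sym nrmc_eq0 subr_eq0 rz.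
move=> r'; rewrite inE ge_min => /predU1P[->|/IH h /h ->//]; by rewrite lexx orbT.
Qed.

(** Let [l = w x]. The other roots of the polynomial [wq], the value of [q] at [w],
    keep away from [l], so [wq] is bounded below on an annulus around [l]. A
    character [phi] whose values on the coefficients are close to those of [w]
    makes [wq.[phi x]] small, and so [phi x] avoids the annulus. These characters
    form a set [F], and [J] is the ideal of the elements vanishing on [F]. As the
    coefficients are separating, a character killing [J] satisfies the inequalities
    defining [F], at least in their weak form, so it also avoids the annulus and
    [separating_idempotent] applies modulo [J] to [x - l *: 1]: it isolates
    the characters of [F] that take [x] near [l]. Multiplication by an element
    vanishing off [F] removes the other characters. *)
Lemma separating_root (q : {poly D}) x : q \is monic -> root q x ->
  (forall i, separating q`_i) -> separating x.
Proof.
move=> q_monic qx0 q_sep w e e0.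
pose l : R[i] := w x.
pose wq : {poly R[i]} := map_poly (w : {rmorphism D -> R[i]^o}) q.
have wq_monic : wq \is monic by exact: monic_map.
have [rs wqE] := closed_field_poly_normal wq.
rewrite (monicP wq_monic) scale1r in wqE.
have [d3 d30 gap] := root_gap rs l.
pose d := Num.min (e / 2) (d3 / 3).
have d0 : 0 < d by rewrite lt_min !divr_gt0.
have d2e : 2 * d <= e by have : d <= e / 2; [by rewrite ge_min lexx|lra].
have d3d : 3 * d <= d3 by have : d <= d3 / 3; [by rewrite ge_min lexx orbT|lra].
have lower z : d <= nrm (z - l) <= 2 * d -> d ^+ size rs <= nrm wq.[z].
  move=> zd; rewrite wqE; elim: rs {wqE} gap => [|r rs IH] gap.
    by rewrite big_nil hornerC expr0 nrmc1.
  rewrite big_cons hornerM hornerXsubC nrmcM exprS; apply: ler_pM.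
  - exact: ltW.
  - by rewrite exprn_ge0 // ltW.
  - have [->|rl] := eqVneq r l; first by case/andP: zd.
    have := gap r (mem_head _ _) rl; have := nrmD (r - z) (z - l).
    by rewrite subrKA (nrmB r z); lra.
  - by apply: IH => r' r'rs; apply: gap; rewrite inE r'rs orbT.
pose K := \sum_(i < size q) nrm x ^+ i.
have K0 : 0 <= K by apply: sumr_ge0 => i _; rewrite exprn_ge0 // nrm_ge0.
pose h := d ^+ size rs / (K + 1).
have h0 : 0 < h by rewrite divr_gt0 ?exprn_gt0 // ltr_wpDl.
have hK : h * K < d ^+ size rs.
  rewrite /h mulrAC ltr_pdivrMr ?ltr_wpDl // ltr_pM2l ?exprn_gt0 // ltrDl //.
pose F : set (character D) :=
  [set phi | forall i : 'I_(size q), nrm (phi q`_i - w q`_i : R[i]) < h].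
have Fw : F w by move=> i; rewrite subrr nrm0.
have Freg : regular_nbhs w F.
  apply: (@filter_forall _ 'I_(size q)
    (fun i phi => nrm (phi q`_i - w q`_i : R[i]) < h) _ (regular_nbhs_filter w)) => i.
  exact: q_sep.
pose J : set D := [set y | forall phi, F phi -> phi y = 0].
have J_ideal : ideal J.
  split.
  - by move=> phi _; exact: character0.
  - move=> y y' Jy Jy' phi Fphi; rewrite -[LHS]/(phi _ : R[i]) characterD.
    by rewrite (Jy _ Fphi) (Jy' _ Fphi) addr0.
  - move=> y y' Jy phi Fphi; rewrite -[LHS]/(phi _ : R[i]) characterM.
    by rewrite (Jy _ Fphi) mul0r.
have hullJ phi : kills phi J -> forall i : 'I_(size q), nrm (phi q`_i - w q`_i : R[i]) <= h.
  move=> phiJ i; rewrite leNgt; apply/negP => hi.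
  have gap0 : 0 < nrm (phi q`_i - w q`_i : R[i]) - h by rewrite subr_gt0.
  have [y phiy y0] := q_sep i phi _ gap0.
  suff : phi y = 0 by rewrite phiy => /eqP; rewrite oner_eq0.
  apply: phiJ => psi Fpsi; apply: y0 => /= psi_near.
  have := Fpsi i; have := nrmD (phi q`_i - psi q`_i : R[i]) (psi q`_i - w q`_i).
  rewrite subrKA (nrmB (phi q`_i : R[i]) (psi q`_i : R[i])); move: psi_near; lra.
have [|f fJ fE] := @separating_idempotent _ _ D_complete J (x - l *: 1) d J_ideal d0.
  move=> phi /hullJ phiF; rewrite -[phi _]/(phi _ : R[i]) characterB characterZ character1 mulr1.
  move=> /lower; apply/negP; rewrite -ltNge; apply: le_lt_trans hK.
  have phiq : \sum_(i < size q) (phi q`_i : R[i]) * (phi x : R[i]) ^+ i = 0.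
    transitivity (phi q.[x] : R[i]); last by rewrite (rootP qx0) character0.
    rewrite horner_coef; elim/big_ind2: _ => [|y u y' u' -> ->|i _].
    - by rewrite character0.
    - by rewrite characterD.
    - by rewrite characterM characterX.
  have wqx : wq.[phi x] +
      \sum_(i < size q) (phi q`_i - w q`_i : R[i]) * (phi x : R[i]) ^+ i = 0.
    rewrite -[RHS]phiq horner_coef size_map_poly_id0; last first.
      by rewrite (monicP q_monic) rmorph1 oner_eq0.
    rewrite -big_split; apply: eq_bigr => i _ /=.
    by rewrite coef_map -mulrDl addrC subrK.
  have -> : wq.[phi x] = - \sum_(i < size q) (phi q`_i - w q`_i : R[i]) * (phi x : R[i]) ^+ i.
    by apply/eqP; rewrite -addr_eq0 wqx.
  rewrite nrmN mulr_sumr; elim/big_ind2: _ => [|y u y' u' h1 h2|i _]; first by rewrite nrm0.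
    by rewrite (le_trans (nrmD _ _)) // lerD.
  rewrite nrmcM nrmcX; apply: ler_pM; rewrite ?exprn_ge0 ?nrm_ge0 //.
  by rewrite lerXn2r ?nnegrE ?nrm_ge0 // nrm_character.
have [y wy yF] := Freg.
exists (y * f).
  rewrite -[LHS]/(w _ : R[i]) characterM wy mul1r.
  apply: (fE w _).1; first by move=> u; apply.
  rewrite -[LHS]/(w _ : R[i]) characterB characterZ character1 mulr1; exact: subrr.
move=> phi /= /negP; rewrite -leNgt => phix.
rewrite -[LHS]/(phi _ : R[i]) characterM.
have [Fphi|/yF->] := pselect (F phi); last by rewrite mul0r.
rewrite (fE phi _).2 ?mulr0 //; first by move=> u; apply.
rewrite -[phi _]/(phi _ : R[i]) characterB characterZ character1 mulr1.
exact: le_trans phix.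
Qed.
End SeparatingElements.

(** * Regularity of the completion *)
Section Regularity.
Context {R : realType}.

Lemma gelfand_continuous {A : normedComAlg R[i]} (a : A) : continuous (gelfand a).
Proof.
move=> w; have := @initial_continuous _ _ (@character_eval _ A) w.
have FF : Filter (@character_eval _ A @ nbhs w) by apply: fmap_filter; exact: nbhs_filter.
move=> /(iffLR (pointwise_cvgP _ FF)) h; exact: (h a).
Qed.

Context {A B D : normedComAlg R[i]}.

Lemma separating_regular : (forall x : D, separating x) -> regular_algebra D.
Proof.
move=> sep E w Ecl Ew; have FF := regular_nbhs_filter w.
have cw : (@character_eval _ D) @ regular_nbhs w --> (character_eval w : {ptws D -> R[i]^o}).
  apply/pointwise_cvgP => x V /nbhs_ballP[e e0 eV].
  have e0' : 0 < complex.Re e by move: e0; rewrite /= ltcE /= => /andP[].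
  apply: filterS (sep x w _ e0') => phi /= phix; apply: eV; rewrite -ball_normE /=.
  by rewrite -nrmE nrmB -[e]RRe_real ?gtr0_real // ltcR.
have cvgw : regular_nbhs w --> w.
  move=> U [_ [[V Vop <-] Vw VU]]; apply: filterS VU _.
  by apply: cw; exact: open_nbhs_nbhs.
have [d wd dE] : regular_nbhs w (~` E).
  by apply: cvgw; apply: open_nbhs_nbhs; split => //; exact: closed_openC.
exists d; split => // _ [phi Ephi <-] /=; apply: dE; exact.
Qed.

(** A character of [D] restricts to a character of [A] along [f]. *)
Lemma regular_separating (f : {lrmorphism A -> D}) :
  complete_algebra D ->
  isometric f -> regular_algebra A -> forall a, separating (f a).
Proof.
move=> D_complete f_iso A_reg a w e e0.
have pull (phi : character D) : exists psi : character A, forall a, psi a = phi (f a).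
  apply: (@character_of _ _ (fun a => phi (f a))).
  - by move=> x y; rewrite raddfD characterD.
  - by move=> x y; rewrite rmorphM characterM.
  - by move=> z x; rewrite linearZ characterZ.
  - by rewrite rmorph1 character1.
  - by move=> x; rewrite (le_trans (nrm_character D_complete _ _)) // /nrm f_iso.
have [w' w'E] := pull w.
pose E := [set psi : character A | e <= nrm (psi a - w' a : R[i])].
have [||a' [a'E wa']] := A_reg E w'.
- rewrite -[E]setCK; apply: open_closedC; rewrite openE => psi /= /negP; rewrite -ltNge => psie.
  have d0 : 0 < (e - nrm (psi a - w' a : R[i]))%:C by rewrite ltcR subr_gt0.
  have /cvgrPdist_lt/(_ _ d0) := @gelfand_continuous A a psi.
  apply: filterS => phi; rewrite -nrmE ltcR /gelfand => h.
  apply/negP; rewrite -ltNge; have := nrmD (phi a - psi a : R[i]) (psi a - w' a).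
  rewrite subrKA (nrmB (phi a : R[i]) (psi a : R[i])); move: h; lra.
- by rewrite /E /= subrr nrm0 => h; have := lt_le_trans e0 h; rewrite ltxx.
exists (f a'); first by rewrite -w'E.
move=> phi /= /negP; rewrite -leNgt => h; have [psi psiE] := pull phi.
by rewrite -psiE; apply: a'E; exists psi => //; rewrite /E /= psiE w'E.
Qed.

(** The extension is generated by the image [x] of the indeterminate, which is a
    root of the monic polynomial [beta] over [A], and by the elements of [C]. *)
Lemma arens_hoffman_integral (iota : {lrmorphism A -> B}) (beta : {poly A}) (C S : subalgClosed B) :
  beta \is monic -> arens_hoffman_step C S (map_poly iota beta) ->
  (forall c, c \in C -> integralOver iota c) -> forall b, b \in S -> integralOver iota b.
Proof.
move=> beta_monic [pC [t [pC_t [psi [pCE _ psi_range psiC]]]]] C_int b bS.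
have [/= p _ <-] : range psi b by rewrite psi_range.
pose h (r : {poly subalg C}) : B := psi (in_qpoly pC r : arens_hoffman pC_t).
pose x := h 'X.
have hD : {morph h : r s / r + s} by move=> r s; rewrite /h in_qpolyD; exact: (rmorphD psi).
have hM : {morph h : r s / r * s} by move=> r s; rewrite /h in_qpolyM; exact: (rmorphM psi).
have h0 : h 0 = 0 by rewrite /h in_qpoly0; exact: (rmorph0 psi).
have h1 : h 1 = 1 by rewrite /h in_qpoly1; exact: (rmorph1 psi).
have hC c : h c%:P = @subalg_val _ B C c.
  rewrite -psiC; congr (psi _); apply: val_inj => /=.
  by rewrite rmodp_small // size_polyC (leq_ltn_trans (leq_b1 _)) // size_mk_monic_gt1.
(* both sides are ring morphisms that agree on constants and on the indeterminate *)
have hE r : h r = (map_poly (@subalg_val _ B C) r).[x].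
  elim/poly_ind: r => [|r c IH]; first by rewrite h0 rmorph0 horner0.
  by rewrite hD hM hC IH rmorphD rmorphM /= map_polyX map_polyC hornerMXaddC.
have pE : psi p = h (p : {poly subalg C}).
  congr (psi _); apply: val_inj => /=; rewrite rmodp_small //; exact: (size_mk_monic p).
have x_root : root (map_poly iota beta) x.
  rewrite -pCE rootE -hE; have [pC_monic pC_size _ _] := pC_t.
  apply/eqP; rewrite -h0; congr (psi _); apply: val_inj => /=.
  by rewrite /mk_monic pC_size pC_monic rmodpp // rmod0p.
rewrite pE hE; apply: (@integral_horner_root _ _ _ x (map_poly iota beta)) => //.
- exact: monic_map.
- by apply/integral_poly => i; rewrite coef_map; exact: integral_id.
- by apply/integral_poly => i; rewrite coef_map; apply: C_int; exact: valP.
Qed.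

(** By transfinite induction: at the least stage containing an element that is not
    integral over [A], the base of the step would consist of integral elements. *)
Lemma standard_extension_integral (iota : {lrmorphism A -> B}) (U : set {poly A})
    (le : rel {poly A}) (alpha0 : {poly A}) (Bs : {poly A} -> subalgClosed B) :
  standard_extension iota U le alpha0 Bs -> forall b, integralOver iota b.
Proof.
move=> SE b.
pose good beta := forall b, b \in Bs beta -> integralOver iota b.
suff goodU beta : U beta -> good beta.
  have : [set: B] b by [].
  by rewrite -(se_cover SE) => -[beta Ub bB]; exact: goodU bB.
move=> Ubeta; apply: contrapT => ngood.
pose bad : {pred {poly A}} := fun beta => `[< U beta /\ ~ good beta >].
have SEwo : forall X : {pred {poly A}}, {subset X <= [in U]} -> nonempty X ->
    exists! z, minimum_of le X z by exact: se_well_order SE.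
have [||g [[gbad gmin] _]] := SEwo bad.
- by move=> a /asboolP[Ua _]; rewrite inE.
- by exists beta; apply/asboolP.
have [Ug ngoodg] := asboolP _ gbad; apply: ngoodg.
have [C CE stepC] := se_step SE Ug.
apply: arens_hoffman_integral stepC _; first exact: (se_monic SE).
move=> c cC; have : below iota U le alpha0 Bs g c by rewrite -CE.
rewrite /below; case: ifP => [_ [a _ <-]|_ [a [Ua ag ga] ca]]; first exact: integral_id.
have [//|na] := pselect (good a); first exact.
have ga' : le g a by apply: gmin; apply/asboolP.
case/eqP: ga; apply: (wo_chain_antisymmetric (se_well_order SE)); rewrite ?inE //.
by rewrite ag.
Qed.
End Regularity.

Theorem proposition2p2p1p1 (R : realType)
    (A B D : normedComAlg R[i])
    (iota : {lrmorphism A -> B})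
    (U : set {poly A}) (le : rel {poly A}) (alpha0 : {poly A})
    (Bs : {poly A} -> subalgClosed B)
    (j : {lrmorphism B -> D}) :
  regular_algebra A ->
  standard_extension iota U le alpha0 Bs ->
  is_completion j ->
  regular_algebra D.
Proof.
move=> A_reg SE [j_iso j_dense D_complete].
apply: separating_regular => x; apply: separating_limit => // e e0.
have [b xb] : exists b, nrm (x - j b) <= e.
  have e0' : 0 < e%:C by rewrite ltcR.
  have [|y [xy [b _ yb]]] := j_dense (ball x e%:C) _ (ball_open _ _).
    by exists x; exact: ballxx.
  by exists b; move: xy; rewrite -yb -ball_normE /= -nrmE ltcR; exact: ltW.
exists (j b) => //.
have [p p_monic pb0] := standard_extension_integral SE b.
apply: (@separating_root _ _ D_complete (map_poly j (map_poly iota p))).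
- by rewrite !monic_map.
- exact: rmorph_root.
move=> i; rewrite !coef_map.
apply: (@regular_separating _ A D (j \o iota)) => //.
by move=> a; rewrite /= j_iso (se_isometric SE).
Qed.
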